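(* Let $\mathcal{C}$ be an abelian category, let $\mathcal{X}\subseteq\mathcal{C}$ be a left thick class, and let $\mathcal{T}=\mathrm{add}(\mathcal{T})\subseteq\mathcal{C}$ be a class such that $\mathcal{T}\subseteq\mathcal{T}^{\perp}\cap\mathcal{X}$. Then the following statements hold true. (a) The class $\mathcal{Q}:=({}^{\perp}\mathcal{T}\cap\mathcal{X},\mathcal{T})_{\infty}^{\vee}$ is left thick. (b) $\mathcal{T}_{\mathcal{X}}^{\vee}=\mathcal{T}^{\vee}=\{M\in\mathcal{Q} : \mathrm{id}_{\mathcal{Q}}(M)<\infty\}$ and it is left thick.
   Context: $\mathrm{add}(\mathcal{M})$ is the class of all direct summands of finite coproducts of objects in $\mathcal{M}$. With $\mathrm{Ext}$ the Yoneda Ext, $\mathcal{T}^{\perp}:=\{C : \mathrm{Ext}^i_{\mathcal{C}}(T,C)=0\ \forall T\in\mathcal{T},\ i\ge1\}$ and ${}^{\perp}\mathcal{T}:=\{C : \mathrm{Ext}^i_{\mathcal{C}}(C,T)=0\ \forall T\in\mathcal{T},\ i\ge1\}$. For a class $\mathcal{A}$ and an object $C$, $\mathrm{id}_{\mathcal{A}}(C):=\min\{n\in\mathbb{N} : \mathrm{Ext}^k_{\mathcal{C}}(A,C)=0\ \forall A\in\mathcal{A},\ \forall k>n\}$ (with $0\in\mathbb N$; $\infty$ if no such $n$). A class is left thick if it is closed under extensions, direct summands and epi-kernels, where $\mathcal{M}$ is closed under epi-kernels if for every exact sequence $0\to M''\to M'\to M\to0$ with $M',M\in\mathcal{M}$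 one has $M''\in\mathcal{M}$. For classes $\mathcal{P},\mathcal{R}\subseteq\mathcal{C}$ and $M\in\mathcal{C}$: an $\mathcal{R}_{\mathcal{P}}$-coresolution of $M$ is an exact sequence $0\to M\xrightarrow{f_0}R_0\xrightarrow{f_1}R_1\to\cdots\to R_{n-1}\xrightarrow{f_n}R_n\to\cdots$ with $R_k\in\mathcal{R}\cup\{0\}$ for all $k\ge0$ and $\mathrm{Im}(f_i)\in\mathcal{P}\cup\{0\}$ for all $i\ge1$. A finite $\mathcal{R}_{\mathcal{P}}$-coresolution of $M$ is an exact sequence $0\to M\xrightarrow{f_0}R_0\xrightarrow{f_1}R_1\to\cdots\xrightarrow{f_n}R_n\to0$ (some $n\ge0$) with $R_n\in\mathcal{P}\cap\mathcal{R}$, $R_k\in\mathcal{R}$ for $0\le k\le n-1$, and $\mathrm{Im}(f_i)\in\mathcal{P}$ for $1\le i\le n-1$. $\mathcal{R}_{\mathcal{P},\infty}^{\vee}$ (resp. $\mathcal{R}_{\mathcal{P}}^{\vee}$) is the class of all objects having an $\mathcal{R}_{\mathcal{P}}$-coresolution (resp. a finite one), and $(\mathcal{P},\mathcal{R})_{\infty}^{\vee}:=\mathcal{P}\cap\mathcal{R}_{\mathcal{P},\infty}^{\vee}$. When $\mathcal{P}=\mathcal{C}$ the symbol $\mathcal{P}$ is omitted, so $\mathcal{T}^{\vee}=\mathcal{T}_{\mathcal{C}}^{\vee}$. *)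

(* Defs.v *)
From Stdlib Require Import Relation_Operators.
From Stdlib Require List.
From mathcomp Require Import all_boot all_algebra.
From mathcomp Require Import boolp classical_sets.
Set Implicit Arguments.
Unset Strict Implicit.
Unset Printing Implicit Defensive.
Import GRing.Theory.
Local Open Scope classical_set_scope.
Local Open Scope ring_scope.

(* Classes of objects are predicates [set C].  Every class to which the theorem
   applies a notion defined "up to isomorphism" (zero object, image, kernel) is
   closed under isomorphisms, since it is closed under direct summands. *)

Record preadditiveCategory := PreadditiveCategory {
  ob :> Type;
  hom : ob -> ob -> zmodType;
  idm : forall A, hom A A;
  comp : forall A B D, hom B D -> hom A B -> hom A D;
  compA : forall A B D E (h : hom D E) (g : hom B D) (f : hom A B),
    comp h (comp g f) = comp (comp h g) f;
  comp1m : forall A B (f : hom A B), comp (idm B) f = f;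
  compm1 : forall A B (f : hom A B), comp f (idm A) = f;
  compDl : forall A B D (g h : hom B D) (f : hom A B),
    comp (g + h) f = comp g f + comp h f;
  compDr : forall A B D (h : hom B D) (f g : hom A B),
    comp h (f + g) = comp h f + comp h g
}.
Arguments idm {p} A.
Arguments comp {p A B D}.

Notation "g ∘ f" := (comp g f) (at level 40, left associativity).

Section Preadditive.
Variable C : preadditiveCategory.
Implicit Types A B D K Q Z : C.

Definition mono A B (f : hom A B) : Prop :=
  forall Z (g h : hom Z A), f ∘ g = f ∘ h -> g = h.

Definition epi A B (f : hom A B) : Prop :=
  forall Z (g h : hom B Z), g ∘ f = h ∘ f -> g = h.

Definition iso A B : Prop :=
  exists (f : hom A B) (g : hom B A), g ∘ f = idm A /\ f ∘ g = idm B.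

Definition is_zero : set C := [set A | idm A = 0].

Definition is_kernel A B K (f : hom A B) (k : hom K A) : Prop :=
  f ∘ k = 0 /\
  forall Z (g : hom Z A), f ∘ g = 0 -> exists! h : hom Z K, k ∘ h = g.

Definition is_cokernel A B Q (f : hom A B) (q : hom B Q) : Prop :=
  q ∘ f = 0 /\
  forall Z (g : hom B Z), g ∘ f = 0 -> exists! h : hom Q Z, h ∘ q = g.

(* Im f = Ker g: the mono part of an epi-mono factorisation of f is a kernel
   of g. *)
Definition exact A B D (f : hom A B) (g : hom B D) : Prop :=
  exists I (e : hom A I) (m : hom I B), [/\ epi e, f = m ∘ e & is_kernel g m].

Definition short_exact A B D (f : hom A B) (g : hom B D) : Prop :=
  [/\ mono f, exact f g & epi g].

(* Im f belongs to P. *)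
Definition image_in (P : set C) A B (f : hom A B) : Prop :=
  exists I (e : hom A I) (m : hom I B), [/\ epi e, mono m, f = m ∘ e & P I].

(* [cons_ob A E] is the sequence A, E 0, E 1, ...  A sequence of morphisms
   A -> E 0 -> E 1 -> ... is a family [d i] from the i-th to the (i+1)-st term
   of it, with [d 0] starting at A and [d i] at E (i-1) for i >= 1. *)
Definition cons_ob A (E : nat -> C) (i : nat) : C :=
  if i is j.+1 then E j else A.

Definition chain A (E : nat -> C) : Type :=
  forall i, hom (cons_ob A E i) (cons_ob A E i.+1).

End Preadditive.

Record abelianCategory := AbelianCategory {
  underlying :> preadditiveCategory;
  zero_ob : underlying;
  zero_obP : is_zero zero_ob;
  biprod : underlying -> underlying -> underlying;
  in1 : forall A B, hom A (biprod A B);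
  in2 : forall A B, hom B (biprod A B);
  pr1 : forall A B, hom (biprod A B) A;
  pr2 : forall A B, hom (biprod A B) B;
  pr1in1 : forall A B, pr1 A B ∘ in1 A B = idm A;
  pr2in2 : forall A B, pr2 A B ∘ in2 A B = idm B;
  pr1in2 : forall A B, pr1 A B ∘ in2 A B = 0;
  pr2in1 : forall A B, pr2 A B ∘ in1 A B = 0;
  biprodP : forall A B,
    in1 A B ∘ pr1 A B + in2 A B ∘ pr2 A B = idm (biprod A B);
  has_kernel : forall (A B : underlying) (f : hom A B),
    exists K (k : hom K A), is_kernel f k;
  has_cokernel : forall (A B : underlying) (f : hom A B),
    exists Q (q : hom B Q), is_cokernel f q;
  mono_normal : forall (A B : underlying) (f : hom A B), mono f ->
    exists D (g : hom B D), is_kernel g f;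
  epi_normal : forall (A B : underlying) (f : hom A B), epi f ->
    exists D (g : hom D A), is_cokernel g f
}.
Arguments zero_ob {a}.
Arguments zero_obP {a}.
Arguments in1 {a} A B.
Arguments in2 {a} A B.
Arguments pr1 {a} A B.
Arguments pr2 {a} A B.

Section YonedaExt.
Variable C : abelianCategory.
Implicit Types A B : C.

(* Extensions 0 -> B -> E 0 -> ... -> E n -> A -> 0, representing the elements
   of Ext^{n+1}(A, B).  [E i] for i > n and [d i] for i > n are junk. *)
Record extension (n : nat) A B := Extension {
  ext_ob : nat -> C;
  ext_d : chain B ext_ob;
  ext_p : hom (ext_ob n) A;
  ext_mono : mono (ext_d 0%N);
  ext_exact : forall i, (i < n)%N -> exact (ext_d i) (ext_d i.+1);
  ext_exact_p : exact (ext_d n) ext_p;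
  ext_epi : epi ext_p
}.

(* Morphisms of complexes that are the identity on A and on B. *)
Definition ext_morphism n A B (x y : extension n A B) : Prop :=
  exists u : forall i, hom (cons_ob B (ext_ob x) i) (cons_ob B (ext_ob y) i),
    [/\ u 0%N = idm B,
        forall i, (i <= n)%N -> u i.+1 ∘ ext_d x i = ext_d y i ∘ u i
      & ext_p y ∘ u n.+1 = ext_p x].

Definition ext_equiv n A B : extension n A B -> extension n A B -> Prop :=
  clos_refl_sym_trans (extension n A B) (@ext_morphism n A B).

(* The zero element of Ext^{n+1}(A, B): the split extension
   0 -> B -> B (+) A -> A -> 0 for n = 0, and
   0 -> B = B -> 0 -> ... -> 0 -> A = A -> 0 for n > 0.  Both are covered by
   putting B in degree 0, A in degree n, and adding up. *)
Definition ob_if (b : bool) A : C := if b then A else zero_ob.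

Definition pr_if (b : bool) A : hom (ob_if b A) A :=
  if b return hom (ob_if b A) A then idm A else 0.

Definition zero_ext_ob n A B (i : nat) : C :=
  biprod (ob_if (i == 0%N) B) (ob_if (i == n) A).

Definition zero_ext_d n A B : chain B (zero_ext_ob n A B) :=
  fun i => if i is j.+1 then 0 else in1 B (ob_if (0%N == n) A).

Definition zero_ext_p n A B : hom (zero_ext_ob n A B n) A :=
  pr_if (n == n) A ∘ pr2 _ _.

Lemma comp0m A B D (f : hom A B) : (0 : hom B D) ∘ f = 0.
Proof. by apply: (addrI (0 ∘ f)); rewrite -compDl !addr0. Qed.

Lemma compm0 A B D (f : hom B D) : f ∘ (0 : hom A B) = 0.
Proof. by apply: (addrI (f ∘ 0)); rewrite -compDr !addr0. Qed.

Lemma from_zero A B (f g : hom A B) : is_zero A -> f = g.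
Proof. by move=> A0; rewrite -(compm1 f) -(compm1 g) A0 !compm0. Qed.

Lemma to_zero A B (f g : hom A B) : is_zero B -> f = g.
Proof. by move=> B0; rewrite -(comp1m f) -(comp1m g) B0 !comp0m. Qed.

Lemma ob_if_zero (b : bool) A : b = false -> is_zero (ob_if b A).
Proof. by move=> ->; apply: zero_obP. Qed.

Lemma split_mono A B (f : hom A B) (g : hom B A) : g ∘ f = idm A -> mono f.
Proof.
by move=> gf Z u v /(congr1 (comp g)); rewrite !compA gf !comp1m.
Qed.

Lemma split_epi A B (f : hom A B) (g : hom B A) : f ∘ g = idm B -> epi f.
Proof.
by move=> fg Z u v /(congr1 (comp^~ g)); rewrite -!compA fg !compm1.
Qed.

Lemma id_kernel A B : is_kernel (0 : hom A B) (idm A).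
Proof.
split=> [|Z g _]; first by rewrite comp0m.
by exists g; split=> [|h <-]; rewrite comp1m.
Qed.

Lemma zero_kernel A B (f : hom A B) :
  mono f -> is_kernel f (0 : hom zero_ob A).
Proof.
move=> fm; split=> [|Z g fg0]; first by rewrite compm0.
exists 0; split=> [|h _]; last by apply: to_zero; exact: zero_obP.
by rewrite compm0; apply: fm; rewrite compm0 fg0.
Qed.

Lemma in1_kernel A B : is_kernel (pr2 A B) (in1 A B).
Proof.
split=> [|Z g g0]; first exact: pr2in1.
exists (pr1 A B ∘ g); split=> [|h <-]; last by rewrite compA pr1in1 comp1m.
rewrite compA -[RHS]comp1m -(biprodP A B) compDl -[in2 _ _ ∘ _ ∘ g]compA g0.
by rewrite compm0 addr0.
Qed.

Lemma biprod_epi_l A B : is_zero B -> epi (in1 A B).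
Proof.
move=> B0; apply: (@split_epi _ _ _ (pr1 A B)).
rewrite -(biprodP A B) (to_zero (pr2 A B) 0 B0) compm0.
by rewrite addr0.
Qed.

Lemma biprod_mono_r A B : is_zero A -> mono (pr2 A B).
Proof.
move=> A0; apply: (@split_mono _ _ _ (in2 A B)).
rewrite -(biprodP A B) (to_zero (pr1 A B) 0 A0) compm0.
by rewrite add0r.
Qed.

Lemma pr_if_split (b : bool) A : b -> exists g : hom A (ob_if b A),
  pr_if b A ∘ g = idm A /\ g ∘ pr_if b A = idm (ob_if b A).
Proof. by case: b => // _; exists (idm A); rewrite /= comp1m. Qed.

Lemma zero_ext_mono n A B : mono (zero_ext_d n A B 0%N).
Proof. exact: split_mono (pr1in1 _ _). Qed.

Lemma zero_ext_exact n A B i : (i < n)%N ->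
  exact (zero_ext_d n A B i) (zero_ext_d n A B i.+1).
Proof.
move=> lt_in; exists (zero_ext_ob n A B i), (zero_ext_d n A B i), (idm _).
split; [ | by rewrite comp1m | exact: id_kernel].
have A0 : is_zero (ob_if (i == n) A) by apply/ob_if_zero/ltn_eqF.
case: i lt_in A0 => [|j] lt_in A0; first exact: biprod_epi_l.
move=> Z g h _; apply: from_zero; rewrite /is_zero /= -biprodP.
rewrite (to_zero (pr1 _ _) 0 zero_obP) (to_zero (pr2 _ _) 0 A0).
by rewrite !compm0 addr0.
Qed.

Lemma zero_ext_exact_p n A B : exact (zero_ext_d n A B n) (zero_ext_p n A B).
Proof.
have [g [_ gK]] := pr_if_split A (eqxx n).
have pm := split_mono gK.
case: n g gK pm => [|n] g gK pm.
  exists B, (idm B), (in1 _ _); split=> //; first by move=> Z u v; rewrite !compm1.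
    by rewrite compm1.
  by rewrite /zero_ext_p /= comp1m; apply: in1_kernel.
exists zero_ob, 0, 0; split; first by move=> Z u v _; apply: from_zero zero_obP.
  by rewrite compm0.
apply: zero_kernel => Z u v; rewrite /zero_ext_p -!compA => /pm.
exact/biprod_mono_r/zero_obP.
Qed.

Lemma zero_ext_epi n A B : epi (zero_ext_p n A B).
Proof.
have [g [gK _]] := pr_if_split A (eqxx n).
apply: (@split_epi _ _ _ (in2 _ _ ∘ g)).
by rewrite compA -[_ ∘ pr2 _ _ ∘ _]compA pr2in2 compm1.
Qed.

Definition zero_ext n A B : extension n A B :=
  Extension (@zero_ext_mono n A B) (@zero_ext_exact n A B)
    (@zero_ext_exact_p n A B) (@zero_ext_epi n A B).

(* Ext^k(A, B) = 0, where Ext^0 = Hom and Ext^{n+1} is the set of extensions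
   modulo [ext_equiv]. *)
Definition Ext_eq0 (k : nat) A B : Prop :=
  if k is n.+1 then forall x : extension n A B, ext_equiv x (zero_ext n A B)
  else forall f : hom A B, f = 0.

End YonedaExt.

Section Classes.
Variable C : abelianCategory.
Implicit Types (A B D M : C) (P R T X : set C).

Definition direct_summand A B : Prop := exists D, iso (biprod A D) B.

Definition coproduct (s : seq C) : C := foldr (@biprod C) zero_ob s.

Definition add_class T : set C :=
  [set A | exists s : seq C, List.Forall T s /\ direct_summand A (coproduct s)].

Definition right_perp T : set C :=
  [set A | forall B i, T B -> (1 <= i)%N -> Ext_eq0 i B A].

Definition left_perp T : set C :=
  [set A | forall B i, T B -> (1 <= i)%N -> Ext_eq0 i A B].

(* id_P(A), with None standing for infinity. *)
Definition id_rel P A : option nat :=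
  let bound n := `[< forall B k, P B -> (n < k)%N -> Ext_eq0 k B A >] in
  if pselect (exists n, bound n) is left h then Some (ex_minn h) else None.

Definition closed_extensions P : Prop :=
  forall A B D (f : hom A B) (g : hom B D),
    short_exact f g -> P A -> P D -> P B.

Definition closed_summands P : Prop :=
  forall A B, direct_summand A B -> P B -> P A.

Definition closed_epi_kernels P : Prop :=
  forall A B D (f : hom A B) (g : hom B D),
    short_exact f g -> P B -> P D -> P A.

Definition left_thick P : Prop :=
  [/\ closed_extensions P, closed_summands P & closed_epi_kernels P].

(* The class of objects having an (infinite) R_P-coresolution. *)
Definition cores_inf P R : set C :=
  [set M | exists (E : nat -> C) (f : chain M E),
    [/\ mono (f 0%N),
        forall i, exact (f i) (f i.+1),
        forall k, (R `|` @is_zero C) (E k)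
      & forall i, (1 <= i)%N -> image_in (P `|` @is_zero C) (f i)]].

(* The class of objects having a finite R_P-coresolution; [E i] and [f i] for
   i > n are junk. *)
Definition cores_fin P R : set C :=
  [set M | exists (n : nat) (E : nat -> C) (f : chain M E),
    [/\ mono (f 0%N),
        forall i, (i < n)%N -> exact (f i) (f i.+1)
      & epi (f n)] /\
    [/\ (P `&` R) (E n),
        forall k, (k < n)%N -> R (E k)
      & forall i, (1 <= i < n)%N -> image_in P (f i)]].

Definition rel_cores_inf P R : set C := P `&` cores_inf P R.

End Classes.

(* Main.v *)
(* Yoneda extensions are handled as spliced short exact sequences, peeled off at
   the end of the second argument.  The push-forward of B -> E -> ... -> A along g
   vanishes iff g can be continued, through short exact sequences
   D -> J -> L, to a map of the splice that extends over the last middle term;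
   effaceability makes this criterion invariant under equivalence of extensions,
   and the parts of the long exact sequences that are needed follow from it.
   Q is the largest subclass of the left thick class P = ^perp T /\ X each of whose
   objects embeds in an object of T with cokernel in the subclass, so the closure
   properties of Q are proved by coinduction (horseshoe construction).
   If M in Q has finite id_Q, dimension shifting along its coresolution shows that
   some cosyzygy N -> T_n -> N' has Ext^1(N', N) = 0, so the coresolution stops. *)
From Stdlib Require Import Relation_Operators.
From mathcomp Require Import all_boot all_algebra.
From mathcomp Require Import boolp classical_sets.
(* Last, since mathcomp's vector spaces also define [hom]. *)
Require Import Defs.
Local Open Scope classical_set_scope.

Set Implicit Arguments.
Unset Strict Implicit.
Unset Printing Implicit Defensive.
Import GRing.Theory.

(** No Baer sum and no quotient by [ext_equiv] is formed: the theorem only asks when Ext vanishes,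
    so it suffices to know when a class dies after a push-forward ([push_zero]) and when two classes
    agree after push-forwards ([push_eq]). The obstacle is that [ext_equiv] is generated by zigzags
    of morphisms. Both relations therefore quantify existentially over the receiving sequence, and
    two receiving sequences with the same left end always map to a common one, so sums and
    comparisons need no canonical choice. Two continuations of one map differ by a map defined on
    the cokernel term; the class pushed along that difference is killed by enlarging the middle
    term, which is where effaceability enters. Peeling at the second argument keeps [A] fixed, so
    the inductions run over the degree with [B] varying. *)

Section Abelian.
Variable C : abelianCategory.
Implicit Types A B D E K L J N Z : C.
Local Open Scope ring_scope.

(** * Kernels, cokernels and short exact sequences *)

Lemma compNm A B D (g : hom B D) (f : hom A B) : (- g) ∘ f = - (g ∘ f).
Proof. by apply: (addrI (g ∘ f)); rewrite -compDl !subrr comp0m. Qed.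

Lemma compmN A B D (g : hom B D) (f : hom A B) : g ∘ (- f) = - (g ∘ f).
Proof. by apply: (addrI (g ∘ f)); rewrite -compDr !subrr compm0. Qed.

Lemma compBl A B D (g h : hom B D) (f : hom A B) : (g - h) ∘ f = g ∘ f - h ∘ f.
Proof. by rewrite compDl compNm. Qed.

Lemma compBr A B D (h : hom B D) (f g : hom A B) : h ∘ (f - g) = h ∘ f - h ∘ g.
Proof. by rewrite compDr compmN. Qed.

(** Composites are normalised to the left, so an equation for [g ∘ f] can rewrite inside them only
    once a prefix [a] is included. *)
Lemma compE A B D (g : hom B D) (f : hom A B) (h : hom A D) : g ∘ f = h ->
  forall Z (a : hom D Z), a ∘ g ∘ f = a ∘ h.
Proof. by move=> <- Z a; rewrite compA. Qed.

Lemma mono0 A B (f : hom A B) : (forall Z (g : hom Z A), f ∘ g = 0 -> g = 0) -> mono f.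
Proof.
move=> f0 Z g h fgh; apply/eqP; rewrite -subr_eq0; apply/eqP/f0.
by rewrite compBr fgh subrr.
Qed.

Lemma epi0 A B (f : hom A B) : (forall Z (g : hom B Z), g ∘ f = 0 -> g = 0) -> epi f.
Proof.
move=> f0 Z g h fgh; apply/eqP; rewrite -subr_eq0; apply/eqP/f0.
by rewrite compBl fgh subrr.
Qed.

Lemma mono_eq0 A B Z (f : hom A B) (g : hom Z A) : mono f -> f ∘ g = 0 -> g = 0.
Proof. by move=> fm fg; apply: fm; rewrite fg compm0. Qed.

Lemma epi_eq0 A B Z (f : hom A B) (g : hom B Z) : epi f -> g ∘ f = 0 -> g = 0.
Proof. by move=> fe gf; apply: fe; rewrite gf comp0m. Qed.

Lemma mono_id A : mono (idm A).
Proof. by move=> Z u v; rewrite !comp1m. Qed.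

Lemma epi_id A : epi (idm A).
Proof. by move=> Z u v; rewrite !compm1. Qed.

Lemma mono_comp A B D (g : hom B D) (f : hom A B) : mono g -> mono f -> mono (g ∘ f).
Proof. by move=> gm fm Z u v; rewrite -!compA => /gm/fm. Qed.

Lemma epi_comp A B D (g : hom B D) (f : hom A B) : epi g -> epi f -> epi (g ∘ f).
Proof. by move=> ge fe Z u v; rewrite !compA => /fe/ge. Qed.

Lemma mono_compr A B D (g : hom B D) (f : hom A B) : mono (g ∘ f) -> mono f.
Proof. by move=> gfm Z u v fuv; apply: gfm; rewrite -!compA fuv. Qed.

Lemma epi_compl A B D (g : hom B D) (f : hom A B) : epi (g ∘ f) -> epi g.
Proof. by move=> gfe Z u v fuv; apply: gfe; rewrite !compA fuv. Qed.

Lemma ker_mono A B K (f : hom A B) (k : hom K A) : is_kernel f k -> mono k.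
Proof.
case=> fk0 kU; apply: mono0 => Z g kg0.
have [|h [_ hU]] := kU Z 0; first by rewrite compm0.
by rewrite -(hU g kg0) -(hU 0) // compm0.
Qed.

Lemma coker_epi A B K (f : hom A B) (q : hom B K) : is_cokernel f q -> epi q.
Proof.
case=> fk0 kU; apply: epi0 => Z g kg0.
have [|h [_ hU]] := kU Z 0; first by rewrite comp0m.
by rewrite -(hU g kg0) -(hU 0) // comp0m.
Qed.

Lemma ker_lift A B K Z (f : hom A B) (k : hom K A) (g : hom Z A) :
  is_kernel f k -> f ∘ g = 0 -> exists h, k ∘ h = g.
Proof. by case=> _ kU /kU[h []]; exists h. Qed.

Lemma coker_desc A B K Z (f : hom A B) (q : hom B K) (g : hom B Z) :
  is_cokernel f q -> g ∘ f = 0 -> exists h, h ∘ q = g.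
Proof. by case=> _ kU /kU[h []]; exists h. Qed.

Lemma mono_kernel A B K (f : hom A B) (k : hom K A) : mono k -> f ∘ k = 0 ->
  (forall Z (g : hom Z A), f ∘ g = 0 -> exists h, k ∘ h = g) -> is_kernel f k.
Proof.
move=> km fk0 kU; split=> // Z g /kU[h khg]; exists h; split=> // h' kh'.
by apply: km; rewrite khg kh'.
Qed.

Lemma epi_cokernel A B K (f : hom A B) (q : hom B K) : epi q -> q ∘ f = 0 ->
  (forall Z (g : hom B Z), g ∘ f = 0 -> exists h, h ∘ q = g) -> is_cokernel f q.
Proof.
move=> km fk0 kU; split=> // Z g /kU[h khg]; exists h; split=> // h' kh'.
by apply: km; rewrite khg kh'.
Qed.

Lemma mono_kercoker A B Q (f : hom A B) (q : hom B Q) :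
  mono f -> is_cokernel f q -> is_kernel q f.
Proof.
move=> fm qP; have [D [g gP]] := mono_normal fm.
apply: mono_kernel => // [|Z h qh0]; first by case: qP.
have [l lq] := coker_desc qP (proj1 gP).
by apply: (ker_lift gP); rewrite -lq -compA qh0 compm0.
Qed.

Lemma epi_cokerker A B K (f : hom A B) (k : hom K A) :
  epi f -> is_kernel f k -> is_cokernel k f.
Proof.
move=> fe kP; have [D [g gP]] := epi_normal fe.
apply: epi_cokernel => // [|Z h hk0]; first by case: kP.
have [l kl] := ker_lift kP (proj1 gP).
by apply: (coker_desc gP); rewrite -kl compA hk0 comp0m.
Qed.

Lemma mono_epi_inv A B (f : hom A B) : mono f -> epi f ->
  exists g, g ∘ f = idm A /\ f ∘ g = idm B.
Proof.
move=> fm fe; have [D [g gP]] := mono_normal fm.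
have g0 : g = 0 by apply: (epi_eq0 fe); case: gP.
have [|h fh] := ker_lift (g := idm B) gP; first by rewrite g0 comp0m.
by exists h; split=> //; apply: fm; rewrite compA fh comp1m compm1.
Qed.

Lemma biprod_eq Z A B (x y : hom Z (biprod A B)) :
  pr1 A B ∘ x = pr1 A B ∘ y -> pr2 A B ∘ x = pr2 A B ∘ y -> x = y.
Proof.
by move=> h1 h2; rewrite -[x]comp1m -[y]comp1m -biprodP !compDl -!compA h1 h2.
Qed.

Lemma biprod_coeq Z A B (x y : hom (biprod A B) Z) :
  x ∘ in1 A B = y ∘ in1 A B -> x ∘ in2 A B = y ∘ in2 A B -> x = y.
Proof.
by move=> h1 h2; rewrite -[x]compm1 -[y]compm1 -biprodP !compDr !compA h1 h2.
Qed.

Definition pair Z A B (a : hom Z A) (b : hom Z B) : hom Z (biprod A B) :=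
  in1 A B ∘ a + in2 A B ∘ b.

Definition copair Z A B (a : hom A Z) (b : hom B Z) : hom (biprod A B) Z :=
  a ∘ pr1 A B + b ∘ pr2 A B.

Lemma pr1_pair Z A B (a : hom Z A) (b : hom Z B) : pr1 A B ∘ pair a b = a.
Proof. by rewrite compDr !compA pr1in1 pr1in2 comp1m comp0m addr0. Qed.

Lemma pr2_pair Z A B (a : hom Z A) (b : hom Z B) : pr2 A B ∘ pair a b = b.
Proof. by rewrite compDr !compA pr2in1 pr2in2 comp1m comp0m add0r. Qed.

Lemma copair_in1 Z A B (a : hom A Z) (b : hom B Z) : copair a b ∘ in1 A B = a.
Proof. by rewrite compDl -!compA pr1in1 pr2in1 compm1 compm0 addr0. Qed.

Lemma copair_in2 Z A B (a : hom A Z) (b : hom B Z) : copair a b ∘ in2 A B = b.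
Proof. by rewrite compDl -!compA pr1in2 pr2in2 compm1 compm0 add0r. Qed.

Lemma copair_pair Y Z A B (a : hom A Z) (b : hom B Z) (c : hom Y A) (d : hom Y B) :
  copair a b ∘ pair c d = a ∘ c + b ∘ d.
Proof. by rewrite compDr !compA copair_in1 copair_in2. Qed.

Lemma pair_comp Y Z A B (a : hom Z A) (b : hom Z B) (c : hom Y Z) :
  pair a b ∘ c = pair (a ∘ c) (b ∘ c).
Proof. by rewrite compDl -!compA. Qed.

Definition ses B E A (i : hom B E) (p : hom E A) : Prop :=
  is_kernel p i /\ is_cokernel i p.

Lemma ses_mono B E A (i : hom B E) (p : hom E A) : ses i p -> mono i.
Proof. by case=> /ker_mono. Qed.

Lemma ses_epi B E A (i : hom B E) (p : hom E A) : ses i p -> epi p.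
Proof. by case=> _ /coker_epi. Qed.

Lemma ses_comp0 B E A (i : hom B E) (p : hom E A) : ses i p -> p ∘ i = 0.
Proof. by case=> -[]. Qed.

Lemma epi_ses B E A (i : hom B E) (p : hom E A) : epi p -> is_kernel p i -> ses i p.
Proof. by move=> pe ik; split=> //; apply: epi_cokerker. Qed.

Lemma mono_ses B E A (i : hom B E) (p : hom E A) : mono i -> is_cokernel i p -> ses i p.
Proof. by move=> pe ik; split=> //; apply: mono_kercoker. Qed.

Lemma exact_mono_kernel A B D (f : hom A B) (g : hom B D) :
  mono f -> exact f g -> is_kernel g f.
Proof.
move=> fm [I [e [m [ee fE mk]]]].
have em : mono e by apply: (@mono_compr _ _ _ m); rewrite -fE.
have [h [he eh]] := mono_epi_inv em ee.
apply: mono_kernel => //; first by rewrite fE compA (proj1 mk) comp0m.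
move=> Z u /(ker_lift mk)[v <-]; exists (h ∘ v).
by rewrite fE -compA (compA e) eh comp1m.
Qed.

Lemma kernel_exact A B D (f : hom A B) (g : hom B D) : is_kernel g f -> exact f g.
Proof. by move=> fk; exists A, (idm A), f; rewrite compm1; split=> //; apply: epi_id. Qed.

Lemma short_exact_ses A B D (f : hom A B) (g : hom B D) : short_exact f g <-> ses f g.
Proof.
split=> [[fm fg ge]|fgs]; first exact/epi_ses/exact_mono_kernel.
split; [exact: ses_mono fgs | exact/kernel_exact/(proj1 fgs) | exact: ses_epi fgs].
Qed.

(** Exactness sees only the image of [f]. This is used at the seams, where a differential is an epi
    followed by the start of the next piece. *)
Lemma exact_precomp A B D N (f : hom A B) (g : hom B D) (e : hom A N) (m : hom N B) :
  epi e -> f = m ∘ e -> exact f g <-> exact m g.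
Proof.
move=> ee fE; split=> [[I [e' [m' [ee' fE' mk]]]]|[I [e' [m' [ee' mE mk]]]]]; last first.
  by exists I, (e' ∘ e), m'; split=> //; [exact: epi_comp | rewrite fE mE compA].
have [|h hm] := ker_lift (g := m) mk.
  by apply: (epi_eq0 ee); rewrite -compA -fE fE' compA (proj1 mk) comp0m.
exists I, h, m'; split=> //; apply: (@epi_compl _ _ _ _ e).
suff -> : h ∘ e = e' by [].
by apply: (ker_mono mk); rewrite compA hm -fE -fE'.
Qed.

Lemma exact_comp0 A B D (f : hom A B) (g : hom B D) : exact f g -> g ∘ f = 0.
Proof. by case=> I [e [m [_ -> [gm0 _]]]]; rewrite compA gm0 comp0m. Qed.

Lemma kernel_postcomp A B D N (f : hom A B) (g : hom B D) (m : hom D N) :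
  mono m -> is_kernel g f -> is_kernel (m ∘ g) f.
Proof.
move=> mm fk; apply: mono_kernel; first exact: ker_mono fk.
  by rewrite -compA (proj1 fk) compm0.
by move=> Z u; rewrite -compA => /(mono_eq0 mm)/(ker_lift fk).
Qed.

(* Diagrams are chased with generalised elements Z -> A, up to an epi Z' -> Z. *)
Lemma pullback_epi Z E A (p : hom E A) (a : hom Z A) : epi p ->
  exists P (u : hom P E) (c : hom P Z), [/\ epi c, p ∘ u = a ∘ c,
    forall Y (v : hom Y E) (w : hom Y Z), p ∘ v = a ∘ w ->
      exists h, u ∘ h = v /\ c ∘ h = w
  & forall Y (h : hom Y P), u ∘ h = 0 -> c ∘ h = 0 -> h = 0].
Proof.
move=> pe; pose d := copair p (- a).
have de : epi d by apply: (@epi_compl _ _ _ _ (in1 _ _)); rewrite copair_in1.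
have [P [k kP]] := has_kernel d.
have kC := epi_cokerker de kP.
exists P, (pr1 _ _ ∘ k), (pr2 _ _ ∘ k); split.
- apply: epi0 => Y h; rewrite compA => /(coker_desc kC)[h' h'd].
  have h'0 : h' = 0.
    by apply: (epi_eq0 pe); rewrite -(copair_in1 p (- a)) compA h'd -compA pr2in1 compm0.
  by rewrite -[h]compm1 -(pr2in2 E Z) compA -h'd h'0 !comp0m.
- have := proj1 kP; rewrite /d /copair compDl -!compA compNm.
  by move/eqP; rewrite subr_eq0 => /eqP.
- move=> Y v w pvw; have [|h kh] := ker_lift (g := pair v w) kP.
    by rewrite copair_pair compNm pvw subrr.
  by exists h; rewrite -!compA kh pr1_pair pr2_pair.
- move=> Y h h1 h2; apply: (mono_eq0 (ker_mono kP)).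
  by apply: biprod_eq; rewrite compA ?h1 ?h2 compm0.
Qed.

Lemma epi_cover Z E A (p : hom E A) (a : hom Z A) : epi p ->
  exists P (c : hom P Z) (u : hom P E), epi c /\ p ∘ u = a ∘ c.
Proof. by move=> /(pullback_epi a)[P [u [c [ce pu _ _]]]]; exists P, c, u. Qed.

Lemma epi_of_cover E A (p : hom E A) :
  (forall Z (a : hom Z A), exists P (c : hom P Z) (u : hom P E), epi c /\ p ∘ u = a ∘ c) ->
  epi p.
Proof.
move=> /(_ A (idm A))[P [c [u [ce]]]]; rewrite comp1m => pu.
by apply: (@epi_compl _ _ _ _ u); rewrite pu.
Qed.

(** It is enough to lift through [i] after an epi: the composite with the cokernel of [i] then
    vanishes on the cover, hence on [Z]. *)
Lemma ses_of_cover B E A (i : hom B E) (p : hom E A) :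
  mono i -> epi p -> p ∘ i = 0 ->
  (forall Z (a : hom Z E), p ∘ a = 0 ->
     exists P (c : hom P Z) (b : hom P B), epi c /\ i ∘ b = a ∘ c) ->
  ses i p.
Proof.
move=> im pe pi0 ex; apply: epi_ses => //; apply: mono_kernel => // Z a pa0.
have [P [c [b [ce ib]]]] := ex Z a pa0.
have [Q [q qP]] := has_cokernel i.
apply: (ker_lift (mono_kercoker im qP)); apply: (epi_eq0 ce).
by rewrite -compA -ib compA (proj1 qP) comp0m.
Qed.

Lemma ses_biprod A B : ses (in1 A B) (pr2 A B).
Proof. by apply: epi_ses; [apply: split_epi (pr2in2 _ _) | apply: in1_kernel]. Qed.

Lemma ses_id_zero A : ses (idm A) (0 : hom A zero_ob).
Proof.
apply: mono_ses; first exact: mono_id.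
apply: epi_cokernel; first by move=> Z u v _; apply: from_zero zero_obP.
  by rewrite comp0m.
by move=> Z g; rewrite compm1 => ->; exists 0; rewrite comp0m.
Qed.

Lemma ses_zero_id A : ses (0 : hom zero_ob A) (idm A).
Proof.
by apply: epi_ses; [exact: epi_id | apply: zero_kernel; exact: mono_id].
Qed.

Lemma ses_pullback B E A A' (i : hom B E) (p : hom E A) (f : hom A' A) : ses i p ->
  exists E' (i' : hom B E') (p' : hom E' A') (u : hom E' E),
    [/\ ses i' p', u ∘ i' = i, p ∘ u = f ∘ p' &
    forall Y (v : hom Y E) (w : hom Y A'), p ∘ v = f ∘ w ->
      exists h, u ∘ h = v /\ p' ∘ h = w].
Proof.
move=> ip; have [P [u [c [ce pu uU uM]]]] := pullback_epi f (ses_epi ip).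
have [|i' [ui' ci']] := uU _ i 0; first by rewrite compm0 (ses_comp0 ip).
exists P, i', c, u; split=> //; apply: epi_ses => //.
apply: mono_kernel => //.
  by apply: (@mono_compr _ _ _ u); rewrite ui'; apply: ses_mono ip.
move=> Z a ca0; have [|b ib] := ker_lift (g := u ∘ a) (proj1 ip).
  by rewrite compA pu -compA ca0 compm0.
exists b; apply/eqP; rewrite -subr_eq0; apply/eqP.
by apply: uM; rewrite compBr compA ?ui' ?ci' ?ib ?ca0 ?comp0m subrr.
Qed.

Lemma ses_pushout B E A B' (i : hom B E) (p : hom E A) (g : hom B B') : ses i p ->
  exists E' (i' : hom B' E') (p' : hom E' A) (u : hom E E'),
    [/\ ses i' p', u ∘ i = i' ∘ g, p' ∘ u = p &
    forall Y (v : hom E Y) (w : hom B' Y), v ∘ i = w ∘ g ->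
      exists h, h ∘ u = v /\ h ∘ i' = w].
Proof.
move=> ip; pose d := pair i (- g).
have dm : mono d.
  by apply: (@mono_compr _ _ _ (pr1 _ _)); rewrite pr1_pair; apply: ses_mono ip.
have [E' [q qP]] := has_cokernel d.
have dK := mono_kercoker dm qP.
have qdE : q ∘ in1 _ _ ∘ i = q ∘ in2 _ _ ∘ g.
  have := proj1 qP; rewrite /d /pair compDr !compmN !compA => /eqP.
  by rewrite subr_eq0 => /eqP.
have uU Y (v : hom E Y) (w : hom B' Y) : v ∘ i = w ∘ g ->
    exists h, h ∘ (q ∘ in1 _ _) = v /\ h ∘ (q ∘ in2 _ _) = w.
  move=> vw; have [|h hq] := coker_desc (g := copair v w) qP.
    by rewrite copair_pair compmN vw subrr.
  by exists h; rewrite !compA hq copair_in1 copair_in2.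
have [|p' [p'u p'i]] := uU _ p 0; first by rewrite comp0m (ses_comp0 ip).
exists E', (q ∘ in2 _ _), p', (q ∘ in1 _ _); split=> //.
have im : mono (q ∘ in2 E B').
  apply: mono0 => Z h; rewrite -compA => /(ker_lift dK)[b bE].
  have ib : i ∘ b = 0.
    by rewrite -(pr1_pair i (- g)) -compA bE compA pr1in2 comp0m.
  have b0 := mono_eq0 (ses_mono ip) ib.
  by rewrite -[h]comp1m -(pr2in2 E B') -compA -bE b0 !compm0.
apply: mono_ses => //; apply: epi_cokernel => //.
  by apply: (@epi_compl _ _ _ _ (q ∘ in1 _ _)); rewrite p'u; apply: ses_epi ip.
move=> Z a a0; have [|b bp] := coker_desc (g := a ∘ (q ∘ in1 _ _)) (proj2 ip).
  by rewrite -compA qdE compA a0 comp0m.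
exists b; apply: (coker_epi qP); apply: biprod_coeq; rewrite -!compA.
  by rewrite p'u bp.
by rewrite p'i a0 compm0.
Qed.

(* W is the pullback of J and A over L. *)
Lemma ses_bicartesian B E A B' J L (i : hom B E) (p : hom E A)
    (j : hom B' J) (q : hom J L) (g : hom B B') (u : hom E J) (l : hom A L)
    K (k : hom K B) :
  ses i p -> ses j q -> u ∘ i = j ∘ g -> l ∘ p = q ∘ u -> ses k g ->
  exists W (e : hom E W) (m : hom W (biprod J A)),
    [/\ ses (i ∘ k) e, ses m (copair (- q) l) & m ∘ e = pair u p].
Proof.
move=> ip jq ui lp kg.
have de : epi (copair (- q) l).
  apply: (@epi_compl _ _ _ _ (in1 _ _)); rewrite copair_in1.
  apply: epi0 => Z h; rewrite compmN => /eqP; rewrite oppr_eq0 => /eqP.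
  exact: epi_eq0 (ses_epi jq).
have [W [m mP]] := has_kernel (copair (- q) l).
have [|e me] := ker_lift (g := pair u p) mP.
  by rewrite copair_pair compNm lp addNr.
have mm := ker_mono mP.
exists W, e, m; split=> //; last exact: epi_ses.
apply: ses_of_cover.
- exact: mono_comp (ses_mono ip) (ses_mono kg).
- apply: epi_of_cover => Z w.
  have [P [c [t [ce pt]]]] := epi_cover (pr2 _ _ ∘ m ∘ w) (ses_epi ip).
  have /(ker_lift (proj1 jq))[b jb] : q ∘ (u ∘ t - pr1 _ _ ∘ m ∘ w ∘ c) = 0.
    rewrite compBr compA -lp -compA pt.
    have := proj1 mP; rewrite /copair compDl compNm => /eqP.
    rewrite compNm addrC subr_eq0 => /eqP mE.
    by rewrite !compA mE subrr.
  have [P' [c' [b' [ce' gb']]]] := epi_cover b (ses_epi kg).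
  exists P', (c ∘ c'), (t ∘ c' - i ∘ b'); split; first exact: epi_comp.
  apply: mm; rewrite compA me.
  apply: biprod_eq; rewrite compA ?pr1_pair ?pr2_pair compBr !compA.
    by rewrite ui (compE gb') compA jb compBl opprB addrC subrK.
  by rewrite (ses_comp0 ip) comp0m subr0 pt.
- apply: mm; rewrite compm0 compA me pair_comp !compA ui (compE (ses_comp0 kg)).
  by rewrite (ses_comp0 ip) comp0m /pair !compm0 addr0.
- move=> Z a ea0.
  have ua0 : u ∘ a = 0 by rewrite -(pr1_pair u p) -me -!compA ea0 !compm0.
  have pa0 : p ∘ a = 0 by rewrite -(pr2_pair u p) -me -!compA ea0 !compm0.
  have [b ib] := ker_lift (proj1 ip) pa0.
  have gb0 : g ∘ b = 0.
    by apply: (mono_eq0 (ses_mono jq)); rewrite compA -ui -compA ib.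
  have [b' kb] := ker_lift (proj1 kg) gb0.
  by exists Z, (idm Z), b'; rewrite compm1 -compA kb; split=> //; apply: epi_id.
Qed.

(** Third isomorphism theorem with W = J/B1: the sequence [kr] is B2/B1 -> J/B1 -> J/B2. *)
Lemma ses_noether B1 B2 B3 J L (i : hom B1 B2) (p : hom B2 B3)
    (j : hom B2 J) (q : hom J L) : ses i p -> ses j q ->
  exists W (w : hom J W) (k : hom B3 W) (r : hom W L),
    [/\ ses (j ∘ i) w, ses k r, k ∘ p = w ∘ j & r ∘ w = q].
Proof.
move=> ip jq; have jim := mono_comp (ses_mono jq) (ses_mono ip).
have [W [w wP]] := has_cokernel (j ∘ i).
have wK := mono_kercoker jim wP.
have [|k kp] := coker_desc (g := w ∘ j) (proj2 ip).
  by rewrite -compA (proj1 wP).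
have [|r rw] := coker_desc (g := q) wP.
  by rewrite compA (ses_comp0 jq) comp0m.
exists W, w, k, r; split=> //.
have we := coker_epi wP.
apply: ses_of_cover.
- apply: mono0 => Z b kb0.
  have [P [c [t [ce pt]]]] := epi_cover b (ses_epi ip).
  have /(ker_lift wK)[b' jib] : w ∘ (j ∘ t) = 0.
    by rewrite compA -kp -compA pt compA kb0 comp0m.
  have tE : t = i ∘ b' by apply: (ses_mono jq); rewrite -jib compA.
  by apply: (epi_eq0 ce); rewrite -pt tE compA (ses_comp0 ip) comp0m.
- by apply: (@epi_compl _ _ _ _ w); rewrite rw; apply: ses_epi jq.
- apply: (epi_eq0 (ses_epi ip)).
  by rewrite -compA kp compA rw (ses_comp0 jq).
- move=> Z a ra0.
  have [P [c [t [ce wt]]]] := epi_cover a we.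
  have /(ker_lift (proj1 jq))[b jb] : q ∘ t = 0.
    by rewrite -rw -compA wt compA ra0 comp0m.
  by exists P, c, (p ∘ b); rewrite compA kp -compA jb wt.
Qed.

End Abelian.

(** * Splices of short exact sequences and their push-forwards *)

Section SpliceExt.
Variable C : abelianCategory.
Implicit Types A B D E K L J N Z : C.
Local Open Scope ring_scope.

Record sesT B A := SesT {
  mid : C;
  inj : hom B mid;
  prj : hom mid A;
  sesP : ses inj prj
}.

Definition ses_map B A B' A' (s : sesT B A) (t : sesT B' A')
    (g : hom B B') (u : hom (mid s) (mid t)) (l : hom A A') : Prop :=
  u ∘ inj s = inj t ∘ g /\ l ∘ prj s = prj t ∘ u.
Arguments ses_map {B A B' A'} s t g u l.

(* Representatives of the elements of Ext^{n+1}(A, B). *)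
Fixpoint yext n A B : Type :=
  if n is m.+1 then {K : C & (sesT B K * yext m A K)%type} else sesT B A.

Definition ycons n A B K (s : sesT B K) (y : yext n A K) : yext n.+1 A B :=
  existT _ K (s, y).

(* The pushforward of [x] along [g] is the zero class. *)
Fixpoint push_zero n A B : yext n A B -> forall D, hom B D -> Prop :=
  match n return yext n A B -> forall D, hom B D -> Prop with
  | 0 => fun s D g => exists r : hom (mid s) D, r ∘ inj s = g
  | m.+1 => fun x D g => let: existT K (s, y) := x in
      exists L (t : sesT D L) u (l : hom K L), ses_map s t g u l /\ push_zero y l
  end.

(* The pushforwards of [x] along [g] and of [x'] along [g'] are the same class. *)
Fixpoint push_eq n A B B' : yext n A B -> yext n A B' ->
    forall D, hom B D -> hom B' D -> Prop :=
  match n return yext n A B -> yext n A B' ->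
    forall D, hom B D -> hom B' D -> Prop with
  | 0 => fun s s' D g g' => exists L (t : sesT D L) u u' l,
      ses_map s t g u l /\ ses_map s' t g' u' l
  | m.+1 => fun x x' D g g' =>
      let: existT K (s, y) := x in let: existT K' (s', y') := x' in
      exists L (t : sesT D L) u u' (l : hom K L) (l' : hom K' L),
        [/\ ses_map s t g u l, ses_map s' t g' u' l' & push_eq y y' l l']
  end.

Lemma ses_map_comp B A B' A' B'' A'' (s : sesT B A) (t : sesT B' A')
    (r : sesT B'' A'') g u l g' u' l' :
  ses_map s t g u l -> ses_map t r g' u' l' ->
  ses_map s r (g' ∘ g) (u' ∘ u) (l' ∘ l).
Proof.
move=> [ui lp] [u'i l'p]; split; last by rewrite -compA lp !compA l'p.
by rewrite -compA ui !compA u'i.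
Qed.

Lemma ses_map_add B A B' A' (s : sesT B A) (t : sesT B' A') g u l g' u' l' :
  ses_map s t g u l -> ses_map s t g' u' l' ->
  ses_map s t (g + g') (u + u') (l + l').
Proof.
by move=> [ui lp] [u'i l'p]; split; rewrite compDl compDr ?ui ?u'i // lp l'p.
Qed.

Lemma ses_map_id B A (s : sesT B A) : ses_map s s (idm B) (idm _) (idm A).
Proof. by split; rewrite !comp1m !compm1. Qed.

Lemma sesT_pushout B A (s : sesT B A) B' (g : hom B B') :
  exists (t : sesT B' A) u, ses_map s t g u (idm A) /\
    forall Y (v : hom (mid s) Y) (w : hom B' Y), v ∘ inj s = w ∘ g ->
      exists h, h ∘ u = v /\ h ∘ inj t = w.
Proof.
have [E' [i' [p' [u [s' ui up uU]]]]] := ses_pushout g (sesP s).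
by exists (SesT s'), u; split=> //; split; rewrite // up comp1m.
Qed.

(** With the identity on the right end, the left square is a pushout, so [u] and [inj t] are jointly
    epi. *)
Lemma ses_map_coeq B B' A (s : sesT B A) (t : sesT B' A) g u Y (a b : hom (mid t) Y) :
  ses_map s t g u (idm A) -> a ∘ u = b ∘ u -> a ∘ inj t = b ∘ inj t -> a = b.
Proof.
move=> [_ up] abu abi; apply/eqP; rewrite -subr_eq0; apply/eqP.
have [|d dp] := coker_desc (g := a - b) (proj2 (sesP t)).
  by rewrite compBl abi subrr.
suff d0 : d = 0 by rewrite -dp d0 comp0m.
apply: (epi_eq0 (ses_epi (sesP s))); rewrite -[prj s]comp1m up compA dp.
by rewrite compBl abu subrr.
Qed.

Lemma sesT_of_mono B J (j : hom B J) : mono j ->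
  exists L (q : hom J L), ses j q.
Proof. by move=> jm; have [L [q qP]] := has_cokernel j; exists L, q; apply: mono_ses. Qed.

(** The common middle term is the pushout of the two given ones under [D]. This makes independent
    witnesses of [push_zero] comparable. *)
Lemma ses_map_amalgam D L1 L2 (t1 : sesT D L1) (t2 : sesT D L2) :
  exists L (t : sesT D L) u1 l1 u2 l2,
    ses_map t1 t (idm D) u1 l1 /\ ses_map t2 t (idm D) u2 l2.
Proof.
have [E' [i' [p' [u [s' ui up uU]]]]] := ses_pushout (inj t2) (sesP t1).
have [L [q jq]] := sesT_of_mono (mono_comp (ses_mono s') (ses_mono (sesP t2))).
have [|l1 l1p] := coker_desc (g := q ∘ u) (proj2 (sesP t1)).
  by rewrite -compA ui (ses_comp0 jq).
have [|l2 l2p] := coker_desc (g := q ∘ i') (proj2 (sesP t2)).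
  by rewrite -compA (ses_comp0 jq).
by exists L, (SesT jq), u, l1, i', l2; split; split; rewrite /= ?compm1.
Qed.

Lemma push_zero_comp n A B (x : yext n A B) D D' (g : hom B D) (h : hom D D') :
  push_zero x g -> push_zero x (h ∘ g).
Proof.
case: n x => [s [r rg]|n [K [s y]] [L [t [u [l [sm yl]]]]]] /=.
  by exists (h ∘ r); rewrite -compA rg.
have [t' [u' [tm _]]] := sesT_pushout t h.
exists L, t', (u' ∘ u), l; split=> //.
by have := ses_map_comp sm tm; rewrite comp1m.
Qed.

Lemma push_eq_comp n A B B' (x : yext n A B) (x' : yext n A B') D D'
    (g : hom B D) (g' : hom B' D) (h : hom D D') :
  push_eq x x' g g' -> push_eq x x' (h ∘ g) (h ∘ g').
Proof.
case: n x x' => [s s' [L [t [u [u' [l [sm sm']]]]]]|n [K [s y]] [K' [s' y']]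
    [L [t [u [u' [l [l' [sm sm' yl]]]]]]]] /=;
  have [t' [v [tm _]]] := sesT_pushout t h;
  have := ses_map_comp sm tm; have := ses_map_comp sm' tm; rewrite !comp1m => sm2 sm1.
  by exists L, t', (v ∘ u), (v ∘ u'), l.
by exists L, t', (v ∘ u), (v ∘ u'), l, l'.
Qed.

Lemma push_eq_sym n A B B' (x : yext n A B) (x' : yext n A B') D
    (g : hom B D) (g' : hom B' D) : push_eq x x' g g' -> push_eq x' x g' g.
Proof.
elim: n B B' x x' D g g' => [|n IH] B B'.
  move=> s s' D g g' [L [t [u [u' [l [sm sm']]]]]].
  by exists L, t, u', u, l.
move=> [K [s y]] [K' [s' y']] D g g' [L [t [u [u' [l [l' [sm sm' /IH yl]]]]]]] /=.
by exists L, t, u', u, l', l.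
Qed.

Lemma push_zero0 n A B (x : yext n A B) D : push_zero x (0 : hom B D).
Proof.
elim: n B x D => [|n IH] B; first by move=> s D; exists 0; rewrite comp0m.
move=> [K [s y]] D; exists zero_ob, (SesT (ses_id_zero D)), 0, 0; split=> //.
by split; rewrite ?comp0m ?compm0.
Qed.

(** The receiving sequence D = D -> 0 leaves only a zero map to be checked on the tail [y]. *)
Lemma push_zero_retract n A B K (s : sesT B K) (y : yext n A K) D (g : hom B D) :
  (exists r : hom (mid s) D, r ∘ inj s = g) ->
  push_zero (ycons s y) g.
Proof.
move=> [r rg]; exists zero_ob, (SesT (ses_id_zero D)), r, 0.
by split; [split; rewrite /= ?comp1m ?comp0m | apply: push_zero0].
Qed.

Lemma push_zero_add n A B (x : yext n A B) D (g g' : hom B D) :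
  push_zero x g -> push_zero x g' -> push_zero x (g + g').
Proof.
elim: n B x D g g' => [|n IH] B.
  by move=> s D g g' [r rg] [r' rg']; exists (r + r'); rewrite compDl rg rg'.
move=> [K [s y]] D g g' [L [t [u [l [sm yl]]]]] [L' [t' [u' [l' [sm' yl']]]]].
have [L3 [t3 [v [k [v' [k' [tm tm']]]]]]] := ses_map_amalgam t t'.
have := ses_map_add (ses_map_comp sm tm) (ses_map_comp sm' tm').
rewrite !comp1m => sm3; exists L3, t3, (v ∘ u + v' ∘ u'), (k ∘ l + k' ∘ l').
by split=> //; apply: IH; apply: push_zero_comp.
Qed.

(** Effaceability: [J] is the middle term of the push-forward of the first piece, over which [m ∘ g]
    extends by construction. *)
Lemma push_zero_efface n A B (x : yext n A B) D (g : hom B D) :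
  exists J (m : hom D J), mono m /\ push_zero x (m ∘ g).
Proof.
case: n x => [s|n [K [s y]]]; have [t [u [[ui _] _]]] := sesT_pushout s g;
  exists (mid t), (inj t); (split; first exact: ses_mono (sesP t)).
  by exists u.
by apply: push_zero_retract; exists u.
Qed.

Lemma push_zero_transfer n A B B' (x : yext n A B) (x' : yext n A B') D
    (g : hom B D) (g' : hom B' D) :
  push_eq x x' g g' -> push_zero x' g' -> push_zero x g.
Proof.
elim: n B B' x x' D g g' => [|n IH] B B'.
  move=> s s' D g g' [L [t [u [u' [l [[ui lp] [u'i lp']]]]]]] [r rg'] /=.
  (* The retraction [r] makes [l] lift to [v] into [mid t]; subtracting this lift from [u] leaves a
     map into [D]. *)
  have [|v vp] := coker_desc (g := u' - inj t ∘ r) (proj2 (sesP s')).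
    by rewrite compBl -compA rg' u'i subrr.
  have qv : prj t ∘ v = l.
    apply: (coker_epi (proj2 (sesP s'))).
    by rewrite -compA vp compBr compA (ses_comp0 (sesP t)) comp0m subr0 lp'.
  have [|w jw] := ker_lift (g := u - v ∘ prj s) (proj1 (sesP t)).
    by rewrite compBr compA qv lp subrr.
  exists w; apply: (ses_mono (sesP t)).
  by rewrite compA jw compBl ui -compA (ses_comp0 (sesP s)) compm0 subr0.
move=> [K [s y]] [K' [s' y']] D g g' [L [t [u [u' [l [l' [sm sm' yl]]]]]]].
move=> [L1 [t1 [u1 [l1 [sm1 yl1]]]]].
have [L2 [t2 [a [b [a1 [b1 [tm tm1]]]]]]] := ses_map_amalgam t t1.
have := ses_map_comp sm' tm; have := ses_map_comp sm1 tm1.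
rewrite !comp1m => -[e1 f1] [e2 f2].
(* The two continuations of [g'] agree only on B', so their difference is a map [d] on the cokernel
   K'. *)
have [|d dp] := coker_desc (g := a ∘ u' - a1 ∘ u1) (proj2 (sesP s')).
  by rewrite compBl e1 e2 subrr.
have dE : prj t2 ∘ d = b ∘ l' - b1 ∘ l1.
  apply: (coker_epi (proj2 (sesP s'))).
  by rewrite -compA dp compBr compBl f1 f2.
(* The push-forward of [y'] along [d] need not vanish. Enlarging [mid t2] to [J] kills it and
   replaces [t2] by D -> J -> L3. *)
have [J [m [mm md]]] := push_zero_efface y' d.
have [L3 [q jq]] := sesT_of_mono (mono_comp mm (ses_mono (sesP t2))).
have [|c cp] := coker_desc (g := q ∘ m) (proj2 (sesP t2)).
  by rewrite -compA (ses_comp0 jq).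
have tm2 : ses_map t2 (SesT jq) (idm D) m c by split; rewrite // compm1.
have := ses_map_comp (ses_map_comp sm tm) tm2; rewrite !comp1m => sm3.
exists L3, (SesT jq), (m ∘ (a ∘ u)), (c ∘ (b ∘ l)); split=> //.
apply: (IH _ _ y y' _ _ (c ∘ (b ∘ l'))); first by do 2 apply: push_eq_comp.
have -> : c ∘ (b ∘ l') = c ∘ (b1 ∘ l1) + q ∘ (m ∘ d).
  by rewrite (compA q) -cp -compA dE compBr addrC subrK.
by apply: push_zero_add; apply: push_zero_comp => //; apply: push_zero_comp.
Qed.

(* Exactness of Ext(A, B1) -> Ext(A, B2) -> Ext(A, B3). *)
Lemma push_zero_lift n A B (x : yext n A B) B1 B2 B3
    (i : hom B1 B2) (p : hom B2 B3) (f : hom B B2) :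
  ses i p -> push_zero x (p ∘ f) ->
  exists x' : yext n A B1, push_eq x x' f i.
Proof.
elim: n B x B1 B2 B3 i p f => [|n IH] B.
  move=> s B1 B2 B3 i p f ip [r rg].
  have [t [u [[ui pu] uU]]] := sesT_pushout s f.
  have [h [hu hj]] := uU _ r p rg.
  (* Since [h] extends [p] from B2 to [mid t], its kernel meets B2 in B1 and is an extension of [A]
     by B1 lying over [i]. *)
  have [K [k kP]] := has_kernel h.
  have he : epi h by apply: (@epi_compl _ _ _ _ _ (inj t)); rewrite hj; apply: ses_epi ip.
  have [|i' ki'] := ker_lift (g := inj t ∘ i) kP.
    by rewrite compA hj (ses_comp0 ip).
  have km := ker_mono kP.
  have s' : ses i' (prj t ∘ k).
    apply: ses_of_cover.
    - apply: (@mono_compr _ _ _ _ k); rewrite ki'.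
      exact: mono_comp (ses_mono (sesP t)) (ses_mono ip).
    - apply: epi_of_cover => Z a.
      have [P [c [b [ce pb]]]] := epi_cover a (ses_epi (sesP t)).
      have [P' [c' [b' [ce' pb']]]] := epi_cover (h ∘ b) (ses_epi ip).
      have [|w kw] := ker_lift (g := b ∘ c' - inj t ∘ b') kP.
        by rewrite compBr !compA hj pb' subrr.
      exists P', (c ∘ c'), w; split; first exact: epi_comp.
      rewrite -compA kw compBr !compA (ses_comp0 (sesP t)) comp0m subr0.
      by rewrite pb.
    - by rewrite -compA ki' compA (ses_comp0 (sesP t)) comp0m.
    - move=> Z a; rewrite -compA => /(ker_lift (proj1 (sesP t)))[b jb].
      have [|b' ib'] := ker_lift (g := b) (proj1 ip).
        by rewrite -hj -compA jb compA (proj1 kP) comp0m.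
      exists Z, (idm Z), b'; split; first exact: epi_id.
      by apply: km; rewrite compm1 compA ki' -compA ib' jb.
  exists (SesT s'), A, t, u, k, (idm A); split; split=> //=; by rewrite comp1m.
move=> [K [s y]] B1 B2 B3 i p f ip [L [t3 [u [l [[ui lp] yl]]]]].
have [t [v [vt vU]]] := sesT_pushout s f; have [vi pv] := vt.
have [|h [hv hj]] := vU _ u (inj t3 ∘ p); first by rewrite ui compA.
have lp' : l ∘ prj t = prj t3 ∘ h.
  apply: (ses_map_coeq vt); first by rewrite -!compA hv -pv comp1m.
  rewrite -!compA hj (ses_comp0 (sesP t)) compA (ses_comp0 (sesP t3)).
  by rewrite compm0 comp0m.
(* [W] is the quotient of [mid t] by B1. As [y] dies along [l], its push-forward to
   [biprod (mid t3) K] comes from a class on [W], which is then spliced onto B1 -> mid t -> W. *)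
have [W [e [m [eW mW me]]]] := ses_bicartesian (sesP t) (sesP t3) hj lp' ip.
have [|y' yy'] := IH _ y _ _ _ _ _ (in2 _ _) mW; first by rewrite copair_in2.
exists (ycons (SesT eW) y').
exists K, t, v, (idm _), (idm K), (pr2 _ _ ∘ m); split=> //.
- by split=> /=; rewrite ?comp1m // compm1 -compA me pr2_pair.
- by rewrite -(pr2in2 (mid t3) K); apply: push_eq_comp.
Qed.

End SpliceExt.

Arguments ses_map {C B A B' A'} s t g u l.

(** * Vanishing in the long exact sequences of both arguments *)

Section LongExact.
Variable C : abelianCategory.
Implicit Types A B D E K L J N Z : C.
Local Open Scope ring_scope.

(** The index is shifted: this is the vanishing of Ext^{n+1}(A, B), as [Ext_eq0P] confirms. *)
Definition ext_vanish n A B : Prop := forall x : yext n A B, push_zero x (idm B).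

Lemma push_zero_vanish n A B D (x : yext n A B) (g : hom B D) :
  ext_vanish n A D -> push_zero x g.
Proof.
case: n x => [s v0|n [K [s y]] v0]; have [t [u [sm _]]] := sesT_pushout s g.
  have [r rt] := v0 t; exists (r ∘ u).
  by rewrite -compA (proj1 sm) compA rt comp1m.
have [L [t' [u' [l [sm' yl]]]]] := v0 (ycons t y).
exists L, t', (u' ∘ u), l; split=> //.
by have := ses_map_comp sm sm'; rewrite comp1m compm1.
Qed.

Lemma vanish_retract n A B D (i : hom B D) (r : hom D B) :
  r ∘ i = idm B -> ext_vanish n A D -> ext_vanish n A B.
Proof.
by move=> ri v0 x; rewrite -ri; apply: push_zero_comp; apply: push_zero_vanish.
Qed.

Lemma vanish_middle n A B1 B2 B3 (i : hom B1 B2) (p : hom B2 B3) : ses i p ->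
  ext_vanish n A B1 -> ext_vanish n A B3 -> ext_vanish n A B2.
Proof.
move=> ip v1 v3 x; have [|x' xx'] := push_zero_lift (f := idm B2) (x := x) ip.
  exact: push_zero_vanish.
apply: push_zero_transfer xx' _; rewrite -[i]compm1.
exact: push_zero_comp (v1 x').
Qed.

Lemma vanish_last n A B1 B2 B3 (i : hom B1 B2) (p : hom B2 B3) : ses i p ->
  ext_vanish n.+1 A B1 -> ext_vanish n A B2 -> ext_vanish n A B3.
Proof.
move=> ip v1 v2 y.
have [L [t [u [l [[/= ui lp] yl]]]]] := v1 (ycons (SesT ip) y).
(* With the zero subobject of B1 as kernel, [e] is an isomorphism from B2 to [W]. Hence B2 -> mid t
   (+) B3 -> L is short exact, and [y], placed in the second summand, comes from B2. *)
have [W [e [m [eW mW me]]]] := ses_bicartesian ip (sesP t) ui lp (ses_zero_id B1).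
have em : mono e.
  apply: mono0 => Z a /(ker_lift (proj1 eW))[b <-].
  by rewrite compm0 comp0m.
have [e' [e'e ee']] := mono_epi_inv em (ses_epi eW).
have [|y' yy'] := push_zero_lift (f := in2 _ _) (x := y) mW.
  by rewrite copair_in2.
rewrite -(pr2in2 (mid t) B3); apply: push_zero_comp.
apply: push_zero_transfer yy' _; rewrite -[m]compm1 -ee'.
rewrite compA; apply: push_zero_comp.
by apply: push_zero_vanish.
Qed.

Lemma vanish_first n A B1 B2 B3 (i : hom B1 B2) (p : hom B2 B3) : ses i p ->
  ext_vanish n A B3 -> ext_vanish n.+1 A B2 -> ext_vanish n.+1 A B1.
Proof.
move=> ip v3 v2 [K [s y]].
have [L [t [u [l [[ui lp] yl]]]]] := push_zero_vanish (ycons s y) i v2.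
(* Dividing [J] by B1 instead of B2 turns the witness for B2 into a receiving sequence for B1. The
   class of [y] along [c] dies in [L], so it comes from B3, where it vanishes. *)
have [W [w [k [r [jw kr kp rw]]]]] := ses_noether ip (sesP t).
have [|c cp] := coker_desc (g := w ∘ u) (proj2 (sesP s)).
  by rewrite -compA ui (ses_comp0 jw).
have rc : r ∘ c = l.
  apply: (ses_epi (sesP s)).
  by rewrite -compA cp compA rw lp.
have [|y' yy'] := push_zero_lift (f := c) (x := y) kr; first by rewrite rc.
exists W, (SesT jw), u, c; split; first by split=> //=; rewrite compm1.
apply: push_zero_transfer yy' _; rewrite -[k]compm1.
exact: push_zero_comp (v3 y').
Qed.

Lemma sesT_pullback B A A' (s : sesT B A) (f : hom A' A) :
  exists (t : sesT B A') c, ses_map t s (idm B) c f /\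
    forall B' A'' (r : sesT B' A'') g u (h : hom A'' A'),
      ses_map r s g u (f ∘ h) -> exists v, ses_map r t g v h /\ c ∘ v = u.
Proof.
have [E [i [p [c [ip ci pc cU]]]]] := ses_pullback f (sesP s).
exists (SesT ip), c; split; first by split; rewrite ?compm1.
move=> B' A'' r g u h [ui fp]; have [|v [cv pv]] := cU _ u (h ∘ prj r).
  by rewrite compA -fp.
exists v; split=> //; split=> //=.
have [|b ib] := ker_lift (g := v ∘ inj r) (proj1 ip).
  by rewrite compA pv -compA (ses_comp0 (sesP r)) compm0.
rewrite -ib; congr (_ ∘ _); apply: (ses_mono (sesP s)).
by rewrite -ui -cv -(compA c) -ib compA ci.
Qed.

(** Choice turns the existence statement into a function, as the recursion [ypull] into [Type]
    requires. *)
Definition pull B A A' (s : sesT B A) (f : hom A' A) : sesT B A' :=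
  projT1 (cid (sesT_pullback s f)).

Lemma pullP B A A' (s : sesT B A) (f : hom A' A) :
  exists c, ses_map (pull s f) s (idm B) c f /\
    forall B' A'' (r : sesT B' A'') g u (h : hom A'' A'),
      ses_map r s g u (f ∘ h) -> exists v, ses_map r (pull s f) g v h /\ c ∘ v = u.
Proof. exact: projT2 (cid (sesT_pullback s f)). Qed.

Fixpoint ypull n A B (x : yext n A B) A' (f : hom A' A) : yext n A' B :=
  match n return yext n A B -> yext n A' B with
  | 0 => fun s => pull s f
  | m.+1 => fun x => let: existT K (s, y) := x in ycons s (ypull y f)
  end x.

(* The Yoneda product of [x] with the class of [z]. *)
Fixpoint splice n A1 A3 B (x : yext n A1 B) (z : sesT A1 A3) : yext n.+1 A3 B :=
  match n return yext n A1 B -> yext n.+1 A3 B with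
  | 0 => fun s => ycons (n := 0) s z
  | m.+1 => fun x => let: existT K (s, y) := x in ycons s (splice y z)
  end x.

Lemma push_zero_pull n A B (x : yext n A B) A' (f : hom A' A) D (g : hom B D) :
  push_zero x g -> push_zero (ypull x f) g.
Proof.
elim: n B x D g => [|n IH] B.
  move=> s D g [r rg]; have [c [[ci _] _]] := pullP s f.
  by exists (r ∘ c); rewrite -compA ci compm1.
by move=> [K [s y]] D g [L [t [u [l [sm /IH yl]]]]]; exists L, t, u, l.
Qed.

Lemma push_eq_pull_id n A B (x : yext n A B) A' (f : hom A' A) (s : hom A A') :
  f ∘ s = idm A -> push_eq x (ypull (ypull x f) s) (idm B) (idm B).
Proof.
move=> fs; elim: n B x => [|n IH] B.
  move=> r; have [c [cm _]] := pullP r f; have [d [dm _]] := pullP (pull r f) s.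
  exists A, r, (idm _), (c ∘ d), (idm A); split; first exact: ses_map_id.
  by have := ses_map_comp dm cm; rewrite fs comp1m.
move=> [K [r y]]; exists K, r, (idm _), (idm _), (idm K), (idm K).
by split=> //; exact: ses_map_id.
Qed.

(** Common end of the contravariant arguments: a class pulled back from an Ext that vanishes is
    zero. *)
Lemma vanish_pull n A B D A' (x : yext n A B) (w : yext n A' D)
    (f : hom A A') (g : hom B D) :
  ext_vanish n A' D -> push_eq x (ypull w f) g (idm D) -> push_zero x g.
Proof. by move=> v0 /push_zero_transfer; apply; apply: push_zero_pull. Qed.

Lemma vanish_coretract n A A' B (f : hom A' A) (s : hom A A') :
  f ∘ s = idm A -> ext_vanish n A' B -> ext_vanish n A B.
Proof. by move=> fs v0 x; apply: vanish_pull v0 (push_eq_pull_id x fs). Qed.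

(* Exactness of Ext(A3, D) -> Ext(A2, D) -> Ext(A1, D). *)
Lemma push_zero_colift n A1 A2 A3 (i : hom A1 A2) (p : hom A2 A3) B
    (x : yext n A2 B) D (g : hom B D) :
  ses i p -> push_zero (ypull x i) g ->
  exists w : yext n A3 D, push_eq x (ypull w p) g (idm D).
Proof.
move=> ip; elim: n B x D g => [|n IH] B; last first.
  move=> [K [s y]] D g [L [t [u [l [sm /IH[w yw]]]]]].
  exists (ycons t w), L, t, u, (idm _), l, (idm L).
  by split=> //; exact: ses_map_id.
move=> s D g [r rg]; have [c [[ci pc] cU]] := pullP s i.
have cm : mono c.
  apply: mono0 => Z a ca0.
  have [|b ib] := ker_lift (g := a) (proj1 (sesP (pull s i))).
    apply: (mono_eq0 (ses_mono ip)).
    by rewrite compA pc -compA ca0 compm0.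
  suff b0 : b = 0 by rewrite -ib b0 compm0.
  apply: (mono_eq0 (ses_mono (sesP s))).
  by rewrite -[inj s]compm1 -ci -compA ib.
have cp : ses c (p ∘ prj s).
  apply: epi_ses; first exact: epi_comp (ses_epi ip) (ses_epi (sesP s)).
  apply: mono_kernel => //.
    by rewrite -compA -pc compA (ses_comp0 ip) comp0m.
  move=> Z a; rewrite -compA => /(ker_lift (proj1 ip))[b ib].
  have [|v [_ cv]] := cU _ _ (SesT (ses_zero_id Z)) 0 a b; last by exists v.
  by split; rewrite /= ?compm0 // compm1.
(* The pulled-back middle term is the kernel of mid s -> A3. Pushing this sequence out along [r],
   which extends [g], gives an extension of A3 by [D]. *)
have [t [v [[vi pv] _]]] := sesT_pushout (SesT cp) r.
exists t; have [d [_ dU]] := pullP t p.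
have [|w [wm _]] := dU _ _ s g v (idm _).
  split; last by rewrite compm1 -pv comp1m.
  by rewrite -[inj s]compm1 -ci compA vi -compA rg.
exists A2, (pull t p), w, (idm _), (idm _); split=> //; exact: ses_map_id.
Qed.

(* Exactness of Ext(A2, D) -> Ext(A1, D) -> Ext(A3, D), in degrees n, n, n+1. *)
Lemma push_zero_splice n A1 A3 (z : sesT A1 A3) B (x : yext n A1 B) D (g : hom B D) :
  push_zero (splice x z) g ->
  exists w : yext n (mid z) D, push_eq x (ypull w (inj z)) g (idm D).
Proof.
elim: n B x D g => [|n IH] B; last first.
  move=> [K [s y]] D g [L [t [u [l [sm /IH[w yw]]]]]].
  exists (ycons t w), L, t, u, (idm _), l, (idm L).
  by split=> //; exact: ses_map_id.
move=> s D g [L [t [u [l [sm [r rz]]]]]]; exists (pull t r).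
have [c [cm cU]] := pullP t r; have [|h [hm _]] := cU _ _ s g u (inj z).
  by rewrite rz.
have [d [dm dU]] := pullP (pull t r) (inj z).
have [|v [vm _]] := dU _ _ s g h (idm _); first by rewrite compm1.
exists A1, (pull (pull t r) (inj z)), v, (idm _), (idm _); split=> //.
exact: ses_map_id.
Qed.

Lemma vanish_comiddle n A1 A2 A3 B (i : hom A1 A2) (p : hom A2 A3) : ses i p ->
  ext_vanish n A1 B -> ext_vanish n A3 B -> ext_vanish n A2 B.
Proof.
move=> ip v1 v3 x; have [|w xw] := push_zero_colift (x := x) (g := idm B) ip.
  exact: v1.
exact: vanish_pull v3 xw.
Qed.

Lemma vanish_cofirst n A1 A2 A3 B (i : hom A1 A2) (p : hom A2 A3) : ses i p ->
  ext_vanish n A2 B -> ext_vanish n.+1 A3 B -> ext_vanish n A1 B.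
Proof.
move=> ip v2 v3 x.
have [|w xw] := push_zero_splice (z := SesT ip) (x := x) (g := idm B).
  exact: v3.
exact: vanish_pull v2 xw.
Qed.


End LongExact.

(** * Peeling a term off a chain and prepending one *)

Section Chains.
Variable C : abelianCategory.
Implicit Types A B K N : C.
Local Open Scope ring_scope.

Definition tail_chain A (E : nat -> C) N (m : hom N (E 1%N)) (f : chain A E) :
    chain N (fun i => E i.+1) :=
  fun i => if i is j.+1 then f j.+2 else m.

Definition cons_chain A E0 N (E : nat -> C) (i : hom A E0) (p : hom E0 N)
    (f : chain N E) : chain A (cons_ob E0 E) :=
  fun j => match j with 0 => i | 1 => f 0%N ∘ p | k.+2 => f k.+1 end.

(** By exactness the cokernel [N] of [f 0] is also the image of [f 1], so it serves as the left end
    of the remaining chain. *)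
Lemma chain_head A (E : nat -> C) (f : chain A E) :
  mono (f 0%N) -> exact (f 0%N) (f 1%N) ->
  exists N (e : hom (E 0%N) N) (m : hom N (E 1%N)),
    [/\ ses (f 0%N) e, f 1%N = m ∘ e & mono m].
Proof.
move=> f0 /(exact_mono_kernel f0) fk.
have [N [e eP]] := has_cokernel (f 0%N); have [|m me] := coker_desc (g := f 1%N) eP.
  by case: fk.
exists N, e, m; split=> //; first exact: mono_ses f0 eP.
apply: mono0 => Z a ma0; have [P [c [t [ce et]]]] := epi_cover a (coker_epi eP).
have [|b f0b] := ker_lift (g := t) fk.
  by rewrite -me -(compA m) et compA ma0 comp0m.
by apply: (epi_eq0 ce); rewrite -et -f0b compA (proj1 eP) comp0m.
Qed.

Lemma tail_chain_exact A (E : nat -> C) (f : chain A E) N (e : hom (E 0%N) N) m i :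
  epi e -> f 1%N = m ∘ e -> exact (f i.+1) (f i.+2) ->
  exact (tail_chain m f i) (tail_chain m f i.+1).
Proof. by case: i => [|i] // ee fE /(exact_precomp _ ee fE). Qed.

Lemma cons_chain_exact A E0 N (E : nat -> C) (i : hom A E0) (p : hom E0 N)
    (f : chain N E) j :
  ses i p -> mono (f 0%N) -> (forall k, j = k.+1 -> exact (f k) (f k.+1)) ->
  exact (cons_chain i p f j) (cons_chain i p f j.+1).
Proof.
move=> ip f0; case: j => [_|[|j] fj] /=.
- exact: kernel_exact (kernel_postcomp f0 (proj1 ip)).
- apply: (proj2 (exact_precomp _ (ses_epi ip) (erefl (f 0%N ∘ p)))).
  exact: (fj 0%N erefl).
- exact: (fj j.+1 erefl).
Qed.

End Chains.

Arguments ext_mono {C n A B} e.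
Arguments ext_epi {C n A B} e.
Arguments ext_exact {C n A B} e [i].

(** * Comparison of splices with Yoneda extensions *)

Section Comparison.
Variable C : abelianCategory.
Implicit Types A B D E K L J N Z : C.
Local Open Scope ring_scope.

(** Packed as one object so that a single choice in [of_ext] fixes the whole factorisation. *)
Record ext_split n A B (x : extension n.+1 A B) := ExtSplit {
  split_ob : C;
  split_epi_part : hom (ext_ob x 0%N) split_ob;
  split_mono_part : hom split_ob (ext_ob x 1%N);
  split_ses : ses (ext_d x 0%N) split_epi_part;
  split_fact : ext_d x 1%N = split_mono_part ∘ split_epi_part;
  split_mono_partP : mono split_mono_part
}.

Arguments split_mono_partP {n A B x} e : rename.

Lemma ext_split_ex n A B (x : extension n.+1 A B) : exists h : ext_split x, True.
Proof.
have [//|K [e [m [s f me]]]] := chain_head (ext_mono x) (ext_exact x _).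
by exists (ExtSplit s f me).
Qed.

Section Tail.
Variables (n : nat) (A B : C) (x : extension n.+1 A B) (h : ext_split x).

Lemma ext_tail_exact i : (i < n)%N ->
  exact (tail_chain (split_mono_part h) (ext_d x) i)
        (tail_chain (split_mono_part h) (ext_d x) i.+1).
Proof.
move=> lt_in; apply: tail_chain_exact (ses_epi (split_ses h)) (split_fact h) _.
exact: ext_exact.
Qed.

Lemma ext_tail_exact_p :
  exact (tail_chain (split_mono_part h) (ext_d x) n) (ext_p x).
Proof.
have := ext_exact_p x; move: (ext_p x); clear.
case: n x h => [|m] y k p //=.
by move/(exact_precomp _ (ses_epi (split_ses k)) (split_fact k)).
Qed.

Definition ext_tail : extension n A (split_ob h) :=
  @Extension _ n A (split_ob h) (fun i => ext_ob x i.+1)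
    (tail_chain (split_mono_part h) (ext_d x)) (ext_p x)
    (split_mono_partP h) ext_tail_exact ext_tail_exact_p (ext_epi x).

End Tail.

Lemma ext0_ses A B (x : extension 0 A B) : ses (ext_d x 0%N) (ext_p x).
Proof.
apply: epi_ses; first exact: ext_epi.
exact: exact_mono_kernel (ext_mono x) (ext_exact_p x).
Qed.

Fixpoint of_ext n A B : extension n A B -> yext n A B :=
  match n return extension n A B -> yext n A B with
  | 0 => fun x => SesT (ext0_ses x)
  | m.+1 => fun x => let h := projT1 (cid (ext_split_ex x)) in
      ycons (SesT (split_ses h)) (of_ext (ext_tail h))
  end.

Section Cons.
Variables (n : nat) (A B K : C) (s : sesT B K) (y : extension n A K).
Let d := cons_chain (inj s) (prj s) (ext_d y).

Lemma ext_cons_exact i : (i < n.+1)%N -> exact (d i) (d i.+1).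
Proof.
move=> lt_in; apply: cons_chain_exact (sesP s) (ext_mono y) _.
by move=> k ik; apply: ext_exact; rewrite -ltnS -ik.
Qed.

Lemma ext_cons_exact_p : exact (d n.+1) (ext_p y).
Proof.
rewrite /d; have := ext_exact_p y; move: (ext_p y); clear.
case: n y => [|m] z p //= zp.
apply: (proj2 (exact_precomp _ (ses_epi (sesP s)) (erefl (ext_d z 0%N ∘ prj s)))).
exact: zp.
Qed.

Definition ext_cons : extension n.+1 A B :=
  @Extension _ n.+1 A B (cons_ob (mid s) (ext_ob y)) d (ext_p y)
    (ses_mono (sesP s)) ext_cons_exact ext_cons_exact_p (ext_epi y).

End Cons.

Lemma ses_ext_exact A B (s : sesT B A) :
  exact (inj s) (prj s).
Proof. exact: kernel_exact (proj1 (sesP s)). Qed.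

Definition ses_ext A B (s : sesT B A) : extension 0 A B :=
  @Extension _ 0 A B (fun=> mid s)
    (fun i => if i is j.+1 then 0 else inj s) (prj s)
    (ses_mono (sesP s)) (fun i (h : (i < 0)%N) => False_ind _ (notF h))
    (ses_ext_exact s) (ses_epi (sesP s)).

Fixpoint to_ext n A B : yext n A B -> extension n A B :=
  match n return yext n A B -> extension n A B with
  | 0 => fun s => ses_ext s
  | m.+1 => fun x => let: existT K (s, y) := x in ext_cons s (to_ext y)
  end.

Definition ext_map n A B B' (b : hom B B') (x : extension n A B)
    (y : extension n A B') : Prop :=
  exists u : forall i, hom (cons_ob B (ext_ob x) i) (cons_ob B' (ext_ob y) i),
    [/\ u 0%N = b,
        forall i, (i <= n)%N -> u i.+1 ∘ ext_d x i = ext_d y i ∘ u i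
      & ext_p y ∘ u n.+1 = ext_p x].

(** The first piece of [y] serves as receiving sequence: [x] is mapped to it and [y] stays fixed. *)
Lemma ext_map_push_eq n A B B' (b : hom B B') (x : extension n A B)
    (y : extension n A B') :
  ext_map b x y -> push_eq (of_ext x) (of_ext y) b (idm B').
Proof.
elim: n B B' b x y => [|n IH] B B' b x y [u [u0 ud up]].
  exists A, (of_ext y), (u 1%N), (idm _), (idm A); split; last exact: ses_map_id.
  by split=> /=; [rewrite (ud 0%N) // u0 | rewrite comp1m up].
rewrite /=; case: (cid (ext_split_ex x)) => h /= _; case: (cid (ext_split_ex y)) => k /= _.
have [|l lp] := coker_desc (g := split_epi_part k ∘ u 1%N) (proj2 (split_ses h)).
  by rewrite -compA (ud 0%N) // compA (ses_comp0 (split_ses k)) comp0m.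
exists (split_ob k), (SesT (split_ses k)), (u 1%N), (idm _), l, (idm _).
split; [by split=> //=; rewrite (ud 0%N) // u0 | exact: (ses_map_id (SesT (split_ses k))) | ].
apply: IH; exists (fun i => if i is j.+1
    return hom (cons_ob (split_ob h) (ext_ob (ext_tail h)) i)
               (cons_ob (split_ob k) (ext_ob (ext_tail k)) i)
    then u j.+2 else l); split=> //.
case=> [_|i lt_in]; last by rewrite /= (ud i.+2).
apply: (ses_epi (split_ses h)); rewrite /= -!compA lp -split_fact (ud 1%N) //.
by rewrite (split_fact k) compA.
Qed.

(** [push_eq] is symmetric, so the direction of each arrow of the zigzag is immaterial. *)
Lemma ext_equiv_push_zero n A B (x y : extension n A B) : ext_equiv x y ->
  push_zero (of_ext x) (idm B) <-> push_zero (of_ext y) (idm B).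
Proof.
elim=> [{}x {}y xy|{}x|{}x {}y _ IH|{}x {}y z _ IH1 _ IH2].
- have e := ext_map_push_eq xy.
  by split; apply: push_zero_transfer => //; apply: push_eq_sym.
- by [].
- by split=> /IH.
- by split=> [/IH1/IH2|/IH2/IH1].
Qed.

Lemma zero_ext_push_zero n A B : push_zero (of_ext (zero_ext n A B)) (idm B).
Proof.
case: n => [|n]; first by exists (pr1 _ _); apply: pr1in1.
by apply: push_zero_retract; exists (pr1 _ _); apply: pr1in1.
Qed.

(* A morphism from the spliced complex of [r] to the complex
   B -b-> F 0 -> F 1 -> ... -> F n -p-> A, the identity on A. *)
Fixpoint ymap n A B : yext n A B -> forall F : nat -> C, hom B (F 0%N) ->
    (forall i, hom (F i) (F i.+1)) -> hom (F n) A -> Prop :=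
  match n return yext n A B -> forall F : nat -> C, hom B (F 0%N) ->
    (forall i, hom (F i) (F i.+1)) -> hom (F n) A -> Prop with
  | 0 => fun s F b d p => exists u : hom (mid s) (F 0%N),
      u ∘ inj s = b /\ p ∘ u = prj s
  | m.+1 => fun x F b d p => let: existT K (s, y) := x in
      exists (u : hom (mid s) (F 0%N)) (l : hom K (F 1%N)),
        [/\ u ∘ inj s = b, l ∘ prj s = d 0%N ∘ u &
            @ymap _ _ _ y (fun i => F i.+1) l (fun i => d i.+1) p]
  end.

Lemma ymap_to_ext n A B (r : yext n A B) :
  ymap r (ext_d (to_ext r) 0%N) (fun i => ext_d (to_ext r) i.+1) (ext_p (to_ext r)).
Proof.
elim: n B r => [|n IH] B; first by move=> s; exists (idm _); rewrite comp1m compm1.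
move=> [K [s y]]; exists (idm _), (ext_d (to_ext y) 0%N); rewrite comp1m.
by split; rewrite ?compm1.
Qed.

(** With [ymap_to_ext] this compares [r] with [of_ext (to_ext r)]. The two need not be equal, since
    [of_ext] chooses its own factorisations. *)
Lemma ymap_push_eq n A B B' (r : yext n A B) (x : extension n A B') (b : hom B B') :
  ymap r (ext_d x 0%N ∘ b) (fun i => ext_d x i.+1) (ext_p x) ->
  push_eq r (of_ext x) b (idm B').
Proof.
elim: n B B' r x b => [|n IH] B B'.
  move=> s x b [u [ui up]]; exists A, (of_ext x), u, (idm _), (idm A).
  by split; [split; rewrite //= comp1m up | exact: ses_map_id].
move=> [K [s y]] x b [u [l [ui lp ym]]] /=; case: (cid (ext_split_ex x)) => h /= _.
have [|k kp] := coker_desc (g := split_epi_part h ∘ u) (proj2 (sesP s)).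
  by rewrite -compA ui compA (ses_comp0 (split_ses h)) comp0m.
exists (split_ob h), (SesT (split_ses h)), u, (idm _), k, (idm _).
split; [by split | exact: (ses_map_id (SesT (split_ses h))) | ].
apply: IH => /=; suff -> : split_mono_part h ∘ k = l by [].
apply: (ses_epi (sesP s)).
by rewrite lp -compA kp compA -split_fact.
Qed.

(** For the identity of [B], this and [zero_ext_morphism] connect [x] to the zero extension by the
    zigzag x -> G <- 0, which is all that [ext_equiv] needs. *)
Lemma push_zero_ext_map n A B B' (x : extension n A B) (b : hom B B') :
  push_zero (of_ext x) b -> exists G : extension n A B',
    ext_map b x G /\ exists σ : hom A (ext_ob G n), ext_p G ∘ σ = idm A.
Proof.
elim: n B B' x b => [|n IH] B B' x b.
  move=> [r rb]; exists (ses_ext (SesT (ses_biprod B' A))); split.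
    exists (fun i => match i return hom (cons_ob B (ext_ob x) i)
        (cons_ob B' (fun=> biprod B' A) i) with
      | 0 => b | 1 => pair r (ext_p x) | _ => 0 end).
    split=> //=; last by rewrite pr2_pair.
    case=> //= _; rewrite pair_comp rb (ses_comp0 (ext0_ses x)).
    by rewrite /pair compm0 addr0.
  by exists (in2 _ _); apply: pr2in2.
rewrite /=; case: (cid (ext_split_ex x)) => h /= _ [L [t [u [l [[ui lp] /IH]]]]].
move=> [G [[v [v0 vd vp]] [σ σP]]]; exists (ext_cons t G); split; last by exists σ.
exists (fun i => match i return hom (cons_ob B (ext_ob x) i)
    (cons_ob B' (cons_ob (mid t) (ext_ob G)) i) with
  | 0 => b | 1 => u | j.+2 => v j.+1 end).
split=> //; case=> [|[|i]] lt_in //=.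
  rewrite (split_fact h) compA; have /= -> := vd 0%N (leq0n n).
  by rewrite v0 -!compA lp.
by have /= -> := vd i.+1 lt_in.
Qed.

(** The equality of [i] and [n] is only propositional, hence the cast. In every other degree the
    source is the zero object. *)
Definition at_index (G : nat -> C) n A (σ : hom A (G n)) i : hom (ob_if (i == n) A) (G i) :=
  match @eqP _ i n with
  | ReflectT e => ecast j (hom _ (G j)) (esym e) (σ ∘ pr_if (i == n) A)
  | ReflectF _ => 0
  end.

Lemma at_index_id (G : nat -> C) n A (σ : hom A (G n)) :
  at_index σ n = σ ∘ pr_if (n == n) A.
Proof. by rewrite /at_index; case: eqP => // e; rewrite (eq_irrelevance e erefl). Qed.

Lemma zero_ext_morphism n A B (G : extension n A B) (σ : hom A (ext_ob G n)) :
  ext_p G ∘ σ = idm A -> ext_morphism (zero_ext n A B) G.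
Proof.
move=> σP.
pose l i : hom (ob_if (i == 0%N) B) (ext_ob G i) :=
  if i is j.+1 return hom (ob_if (i == 0%N) B) (ext_ob G i) then 0 else ext_d G 0%N.
exists (fun i => if i is j.+1 return hom (cons_ob B (zero_ext_ob n A B) i)
    (cons_ob B (ext_ob G) i) then copair (l j) (at_index σ j) else idm B).
split=> //.
  case=> [_|i lt_in]; first by rewrite /= copair_in1 compm1.
  rewrite /= compm0; apply: biprod_coeq; rewrite comp0m -compA.
    rewrite copair_in1; case: i lt_in => [|i] lt_in /=; last by rewrite compm0.
    exact/esym/(exact_comp0 (ext_exact G lt_in)).
  by rewrite copair_in2; apply/from_zero/ob_if_zero/ltn_eqF.
rewrite /= /zero_ext_p; apply: biprod_coeq; rewrite -!compA.
  rewrite copair_in1 pr2in1 compm0; case: (n) G σ σP @l => [|m] G σ σP l /=.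
    exact: exact_comp0 (ext_exact_p G).
  by rewrite compm0.
by rewrite copair_in2 pr2in2 compm1 at_index_id compA σP comp1m.
Qed.

Theorem Ext_eq0P n A B : Ext_eq0 n.+1 A B <-> ext_vanish n A B.
Proof.
split=> [x0 r|v0 x].
  apply: (@push_zero_transfer _ _ _ _ _ _ (of_ext (to_ext r)) _ _ (idm B)).
    by apply: ymap_push_eq; rewrite compm1; apply: ymap_to_ext.
  by apply/(ext_equiv_push_zero (x0 (to_ext r)))/zero_ext_push_zero.
have [G [xG [σ /zero_ext_morphism zG]]] := push_zero_ext_map (v0 (of_ext x)).
by apply: rst_trans (rst_step _ _ _ _ xG) _; apply/rst_sym/rst_step.
Qed.

End Comparison.

(** * Thick classes and coresolutions *)

Section Classes.
Variable C : abelianCategory.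
Implicit Types A B D E K L J M N : C.
Implicit Types P R S : set C.
Local Open Scope ring_scope.

Definition retract A B : Prop :=
  exists (s : hom A B) (r : hom B A), r ∘ s = idm A.

Lemma retract_summand A B : retract A B <-> direct_summand A B.
Proof.
split=> [[s [r rs]]|[D [f [g [gf fg]]]]]; last first.
  exists (f ∘ in1 _ _), (pr1 _ _ ∘ g).
  by rewrite -compA (compA g) gf comp1m pr1in1.
(* The complement is the kernel of the retraction, and [idm B - s ∘ r] factors through it. *)
have [D [k kP]] := has_kernel r.
have [|h kh] := ker_lift (g := idm B - s ∘ r) kP.
  by rewrite compBr compm1 compA rs comp1m subrr.
have hk : h ∘ k = idm D.
  apply: (ker_mono kP).
  by rewrite compA kh compBl comp1m -compA (proj1 kP) compm0 subr0 compm1.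
have hs : h ∘ s = 0.
  apply: (mono_eq0 (ker_mono kP)).
  by rewrite compA kh compBl comp1m -compA rs compm1 subrr.
exists D, (copair s k), (pair r h); split; last by rewrite copair_pair kh addrC subrK.
apply: biprod_coeq; apply: biprod_eq;
  rewrite comp1m -compA ?copair_in1 ?copair_in2 compA ?pr1_pair ?pr2_pair.
- by rewrite rs pr1in1.
- by rewrite hs pr2in1.
- by rewrite (proj1 kP) pr1in2.
- by rewrite hk pr2in2.
Qed.

Lemma closed_summandsP P :
  closed_summands P <-> forall A B, retract A B -> P B -> P A.
Proof.
by split=> h A B => [/retract_summand|/retract_summand]; apply: h.
Qed.

Lemma closed_extensionsP P : closed_extensions P <->
  forall A B D (f : hom A B) (g : hom B D), ses f g -> P A -> P D -> P B.
Proof. by split=> h A B D f g /short_exact_ses; apply: h. Qed.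

Lemma closed_epi_kernelsP P : closed_epi_kernels P <->
  forall A B D (f : hom A B) (g : hom B D), ses f g -> P B -> P D -> P A.
Proof. by split=> h A B D f g /short_exact_ses; apply: h. Qed.

Lemma left_perpE P : left_perp P =
  [set A | forall B i, P B -> ext_vanish i A B].
Proof.
apply/seteqP; split=> A h B i PB; first by apply/Ext_eq0P/h.
by case: i => // i _; apply/Ext_eq0P/h.
Qed.

Lemma left_thick_left_perp P : left_thick (left_perp P).
Proof.
rewrite left_perpE; split.
- apply/closed_extensionsP => A B D f g fg hA hD E i PE.
  by apply: vanish_comiddle fg _ _; [apply: hA | apply: hD].
- apply/closed_summandsP => A B [s [r rs]] hB E i PE.
  by apply: vanish_coretract rs _; apply: hB.
- apply/closed_epi_kernelsP => A B D f g fg hB hD E i PE.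
  by apply: vanish_cofirst fg _ _; [apply: hB | apply: hD].
Qed.

Lemma left_thickI P R : left_thick P -> left_thick R -> left_thick (P `&` R).
Proof.
move=> [P1 P2 P3] [R1 R2 R3]; split.
- by move=> A B D f g fg [? ?] [? ?]; split; [apply: P1 fg _ _ | apply: R1 fg _ _].
- by move=> A B AB [? ?]; split; [apply: P2 AB _ | apply: R2 AB _].
- by move=> A B D f g fg [? ?] [? ?]; split; [apply: P3 fg _ _ | apply: R3 fg _ _].
Qed.

Lemma retract_zero Z A : is_zero Z -> retract Z A.
Proof. by move=> Z0; exists 0, 0; apply: to_zero. Qed.

(** Dependent choice iterates the step. Each differential after the first is the epi onto a cosyzygy
    followed by its embedding, so its image lies in [S], hence in [P]. *)
Lemma rel_cores_inf_coind P R S :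
  (forall M, S M -> P M /\ exists E N (i : hom M E) (p : hom E N),
     [/\ ses i p, R E & S N]) ->
  S `<=` rel_cores_inf P R.
Proof.
move=> step M SM; split; first exact: (step M SM).1.
pose st := {N : C | S N}.
have next (x : st) : {y : st & {E : C & {i : hom (sval x) E &
    {p : hom E (sval y) | ses i p /\ R E}}}}.
  have [_ /cid[E /cid[N /cid[i /cid[p [ip RE SN]]]]]] := step _ (svalP x).
  by exists (exist _ N SN), E, i, p.
pose x0 : st := exist _ M SM.
pose x n : st := iter n (fun y => projT1 (next y)) x0.
pose E n := projT1 (projT2 (next (x n))).
pose i n : hom (sval (x n)) (E n) := projT1 (projT2 (projT2 (next (x n)))).
pose p n : hom (E n) (sval (x n.+1)) := sval (projT2 (projT2 (projT2 (next (x n))))).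
have ipR n : ses (i n) (p n) /\ R (E n).
  exact: svalP (projT2 (projT2 (projT2 (next (x n))))).
exists E, (fun n => if n is m.+1
  return hom (cons_ob M E n) (cons_ob M E n.+1) then i m.+1 ∘ p m else i 0%N).
split; first exact: ses_mono (ipR 0%N).1.
- case=> [|n].
    exact/kernel_exact/(kernel_postcomp (ses_mono (ipR _).1))/(ipR 0%N).1.1.
  apply: (proj2 (exact_precomp _ (ses_epi (ipR n).1) erefl)).
  exact/kernel_exact/(kernel_postcomp (ses_mono (ipR _).1))/(ipR n.+1).1.1.
- by move=> k; left; apply: (ipR k).2.
- case=> // n _; exists (sval (x n.+1)), (p n), (i n.+1); split=> //.
  + exact: ses_epi (ipR n).1.
  + exact: ses_mono (ipR n.+1).1.
  + by left; apply: (step _ (svalP (x n.+1))).1.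
Qed.

Lemma closed_summands_zero P A : closed_summands P -> P A -> @is_zero C `<=` P.
Proof. by move=> /closed_summandsP cP PA Z Z0; apply: cP PA; apply: retract_zero. Qed.

(** The factorisation inside [image_in] may differ from the peeled one; membership in [P] is carried
    over along this retract. *)
Lemma image_unique A B I I' (e : hom A I) (m : hom I B) (e' : hom A I') (m' : hom I' B) :
  epi e -> mono m -> epi e' -> mono m' -> m ∘ e = m' ∘ e' -> retract I I'.
Proof.
move=> ee mm ee' mm' em.
have [K [k kP]] := has_kernel e.
have [|h he] := coker_desc (g := e') (epi_cokerker ee kP).
  apply: (mono_eq0 mm'); rewrite compA -em -compA (proj1 kP) compm0 //.
have m'h : m' ∘ h = m by apply: ee; rewrite -compA he em.
have hm : mono h by apply: (@mono_compr _ _ _ _ m'); rewrite m'h.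
have he' : epi h by apply: (@epi_compl _ _ _ _ _ e); rewrite he.
by have [g [gh hg]] := mono_epi_inv hm he'; exists h, g.
Qed.

Lemma rel_cores_inf_unfold P R M :
  closed_summands P -> closed_summands R -> R !=set0 ->
  rel_cores_inf P R M -> exists E N (i : hom M E) (p : hom E N),
    [/\ ses i p, R E & rel_cores_inf P R N].
Proof.
move=> sP sR [R0 RR0] [PM [E [f [f0 fe fR fP]]]].
(* Coresolutions admit zero objects besides [R] and [P]; closure under summands absorbs them, as
   both classes are inhabited. *)
have zP := closed_summands_zero sP PM; have zR := closed_summands_zero sR RR0.
have [N [e [m [s fE mm]]]] := chain_head f0 (fe 0%N).
exists (E 0%N), N, (f 0%N), e; split=> //; first by case: (fR 0%N) => // /zR.
split.
  have [I [e' [m' [ee' mm' fE' IP]]]] := fP 1%N isT.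
  have PI : P I by case: IP => // /zP.
  have /closed_summandsP sP' := sP; apply: sP' PI.
  by apply: image_unique (ses_epi s) mm ee' mm' _; rewrite -fE.
exists (fun i => E i.+1), (tail_chain m f); split=> //.
- by move=> i; apply: tail_chain_exact (ses_epi s) fE (fe i.+1).
- by case=> // i _; apply: (fP i.+2).
Qed.

(** A finite coresolution as [n] short exact steps. Image conditions are left out and restored
    through [lenP] in [cores_len_fin]. *)
Fixpoint cores_len R n M : Prop :=
  if n is m.+1 then exists E N (i : hom M E) (p : hom E N),
    [/\ ses i p, R E & cores_len R m N]
  else R M.

Lemma cores_fin_len R M : closed_summands R -> cores_fin setT R M ->
  exists n, cores_len R n M.
Proof.
move=> /closed_summandsP sR [n [E [f [[f0 fe fn] [[_ RE] RE' _]]]]]; exists n.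
elim: n M E f f0 fe fn RE RE' => [|n IH] M E f f0 fe fn RE RE'.
  have [g [gf _]] := mono_epi_inv f0 fn.
  by apply: sR RE; exists (f 0%N), g.
have [N [e [m [s fE mm]]]] := chain_head f0 (fe 0%N isT).
exists (E 0%N), N, (f 0%N), e; split=> //; first exact: RE'.
apply: (IH N (fun i => E i.+1) (tail_chain m f)) => //.
- by move=> i lt_in; apply: tail_chain_exact (ses_epi s) fE (fe i.+1 lt_in).
- case: n fn {IH fe RE RE'} => [|n] //= fn.
  by apply: (@epi_compl _ _ _ _ _ e); rewrite -fE.
- by move=> k lt_kn; apply: RE'.
Qed.

Lemma cores_len_fin P R n M : R `<=` P ->
  (forall k N, cores_len R k N -> P N) ->
  cores_len R n M -> cores_fin P R M.
Proof.
move=> RP lenP lenM; exists n.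
elim: n M lenM => [|n IH] M.
  move=> RM; exists (fun=> M), (fun i => if i is j.+1
    return hom (cons_ob M (fun=> M) i) (cons_ob M (fun=> M) i.+1) then 0 else idm M).
  split; split=> //; [exact: mono_id | exact: epi_id | | by case].
  by split=> //; apply: RP.
move=> [E [N [i [p [ip RE /[dup] /lenP PN /IH[F [f [[f0 fe fn] [RF RF' fP]]]]]]]]].
exists (cons_ob E F), (cons_chain i p f); split; split.
- exact: ses_mono ip.
- move=> j lt_jn; apply: cons_chain_exact ip f0 _ => k jk.
  by apply: fe; rewrite -ltnS -jk.
- case: n fn {IH fe RF RF' fP} => [|n] // fn.
  exact: epi_comp fn (ses_epi ip).
- by [].
- by case.
- case=> [|[|j]] //= lt_jn; last exact: (fP j.+1).
  by exists N, p, (f 0%N); split=> //; apply: ses_epi ip.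
Qed.

End Classes.

(** * The class Q and finite relative injective dimension *)

Section Tilting.
Variables (C : abelianCategory) (X T : set C).
Hypotheses (hX : left_thick X) (hT : T = add_class T)
  (hTX : T `<=` right_perp T `&` X).
Implicit Types A B D E K L J M N : C.
Local Open Scope ring_scope.

Let P := left_perp T `&` X.
Let Q := rel_cores_inf P T.

Lemma add_retract A B : T B -> retract A B -> T A.
Proof.
move=> TB [s [r rs]]; rewrite hT; exists [:: B]; split; first by constructor=> //; constructor.
apply/retract_summand; exists (in1 _ _ ∘ s), (r ∘ pr1 _ _).
by rewrite -compA (compA (pr1 _ _)) pr1in1 comp1m.
Qed.

Lemma add_summands : closed_summands T.
Proof. by apply/closed_summandsP => A B AB TB; apply: add_retract TB AB. Qed.

Lemma add_zero : T zero_ob.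
Proof.
rewrite hT; exists [::]; split; first by constructor.
by apply/retract_summand/retract_zero/zero_obP.
Qed.

Lemma add_biprod A B : T A -> T B -> T (biprod A B).
Proof.
move=> TA TB; rewrite hT; exists [:: A; B]; split.
  by do 2 (constructor=> //); constructor.
apply/retract_summand.
exists (pair (pr1 _ _) (in1 _ _ ∘ pr2 _ _)), (pair (pr1 _ _) (pr1 _ _ ∘ pr2 _ _)).
apply: biprod_eq; rewrite compA ?pr1_pair ?pr2_pair compm1 //.
by rewrite -compA pr2_pair compA pr1in1 comp1m.
Qed.

Lemma base_thick : left_thick P.
Proof. exact: left_thickI (left_thick_left_perp T) hX. Qed.

Lemma base_vanish i A B : P A -> T B -> ext_vanish i A B.
Proof. by move=> [+ _] TB; rewrite left_perpE; apply. Qed.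

(** Self-orthogonality is symmetric: [T] inside its right perpendicular class is also inside its
    left one. *)
Lemma add_base : T `<=` P.
Proof.
move=> A TA; split; last exact: (hTX TA).2.
by move=> B i TB i1; apply: (hTX TB).1.
Qed.

Lemma rel_unfold M : Q M -> exists E N (i : hom M E) (p : hom E N),
  [/\ ses i p, T E & Q N].
Proof.
apply: rel_cores_inf_unfold; [by case: base_thick | exact: add_summands | ].
by exists zero_ob; apply: add_zero.
Qed.

Lemma add_rel : T `<=` Q.
Proof.
apply: rel_cores_inf_coind => M TM; split; first exact: add_base.
exists M, zero_ob, (idm M), 0; split=> //; first exact: ses_id_zero.
exact: add_zero.
Qed.

Lemma rel_extensions A B D (f : hom A B) (g : hom B D) :
  ses f g -> Q A -> Q D -> Q B.
Proof.
move=> fg QA QD; pose S B := exists A D (f : hom A B) (g : hom B D),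
  [/\ ses f g, Q A & Q D].
suff : S `<=` Q by apply; exists A, D, f, g.
apply: rel_cores_inf_coind => {A B D f g fg QA QD} B [A [D [f [g [fg QA QD]]]]].
have [PE _ _] := base_thick; split.
  by have /closed_extensionsP := PE; apply; [exact: fg | case: QA | case: QD].
have [TA [A' [a [a' [aa TTA QA']]]]] := rel_unfold QA.
have [TD [D' [d [d' [dd TTD QD']]]]] := rel_unfold QD.
(* Ext^1(D, TA) = 0 extends [a] from [A] to [B]; here membership in the left perpendicular class is
   used. *)
have [r ra] : push_zero (n := 0) (SesT fg) a.
  by apply: push_zero_vanish; apply: base_vanish => //; case: QD.
have phim : mono (pair r (d ∘ g)).
  apply: mono0 => Z z z0.
  have rz : r ∘ z = 0 by rewrite -(pr1_pair r (d ∘ g)) -compA z0 compm0.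
  have /(mono_eq0 (ses_mono dd))/(ker_lift (proj1 fg))[y fy] : d ∘ (g ∘ z) = 0.
    by rewrite compA -(pr2_pair r (d ∘ g)) -compA z0 compm0.
  suff y0 : y = 0 by rewrite -fy y0 compm0.
  by apply: (mono_eq0 (ses_mono aa)); rewrite -ra /= -compA fy.
have [B' [q jq]] := sesT_of_mono phim.
have q1 : q ∘ in1 _ _ ∘ r + q ∘ in2 _ _ ∘ d ∘ g = 0.
  by have := ses_comp0 jq; rewrite /pair compDr !compA.
exists (biprod TA TD), B', (pair r (d ∘ g)), q; split=> //; first exact: add_biprod.
have [|k ka] := coker_desc (g := q ∘ in1 _ _) (proj2 aa).
  have := congr1 (comp^~ f) q1; rewrite /= compDl comp0m -!compA.
  by rewrite (ses_comp0 fg) !compm0 addr0 ra.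
have [|l lq] := coker_desc (g := d' ∘ pr2 _ _) (proj2 jq).
  by rewrite -compA pr2_pair compA (ses_comp0 dd) comp0m.
exists A', D', k, l; split=> //; apply: ses_of_cover.
- apply: mono0 => Z z kz0.
  have [W [c [t [ce at_]]]] := epi_cover z (ses_epi aa).
  have /(ker_lift (proj1 jq))[b bE] : q ∘ (in1 _ _ ∘ t) = 0.
    by rewrite compA -ka -compA at_ compA kz0 comp0m.
  have rb : r ∘ b = t by rewrite -(pr1_pair r (d ∘ g)) -compA bE compA pr1in1 comp1m.
  have /(mono_eq0 (ses_mono dd))/(ker_lift (proj1 fg))[y fy] : d ∘ (g ∘ b) = 0.
    by rewrite compA -(pr2_pair r (d ∘ g)) -compA bE compA pr2in1 comp0m.
  apply: (epi_eq0 ce); rewrite -at_ -rb -fy (compA r) ra compA (ses_comp0 aa).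
  by rewrite comp0m.
- apply: (@epi_compl _ _ _ _ _ q); rewrite lq.
  exact: epi_comp (ses_epi dd) (split_epi (pr2in2 _ _)).
- apply: (epi_eq0 (ses_epi aa)).
  by rewrite -compA ka compA lq -compA pr2in1 compm0.
- move=> Z z lz0.
  have [W [c [t [ce qt]]]] := epi_cover z (ses_epi jq).
  have /(ker_lift (proj1 dd))[s ds] : d' ∘ (pr2 _ _ ∘ t) = 0.
    by rewrite compA -lq -compA qt compA lz0 comp0m.
  have [W' [c' [b [ce' gb]]]] := epi_cover s (ses_epi fg).
  (* The TD-component of [t] is [d ∘ s]. Subtracting the image of a lift [b] of [s] to [B] removes
     it without changing the class in B', leaving this TA-component. *)
  exists W', (c ∘ c'), (a' ∘ (pr1 _ _ ∘ t ∘ c' - r ∘ b)).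
  split; first exact: epi_comp.
  have tE : in1 _ _ ∘ pr1 _ _ ∘ t + in2 _ _ ∘ pr2 _ _ ∘ t = t.
    by rewrite -compDl biprodP comp1m.
  have q1b : q ∘ in1 _ _ ∘ r ∘ b = - (q ∘ in2 _ _ ∘ pr2 _ _ ∘ t ∘ c').
    have := congr1 (comp^~ b) q1; rewrite /= compDl comp0m => /eqP.
    rewrite addr_eq0 => /eqP ->; congr (- _).
    by rewrite (compE gb) (compA _ s) (compE ds) !compA.
  rewrite compA ka (compA z) -qt compBr !compA q1b opprK.
  by rewrite -[in RHS]tE !compDr !compDl !compA.
Qed.

Lemma rel_epi_kernels A B D (f : hom A B) (g : hom B D) :
  ses f g -> Q B -> Q D -> Q A.
Proof.
move=> fg QB QD; have [_ _ /closed_epi_kernelsP PK] := base_thick.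
have PA : P A by apply: PK fg _ _; [case: QB | case: QD].
have [E [B' [j [q [jq TE QB']]]]] := rel_unfold QB.
have [W [w [k [r [jw kr _ _]]]]] := ses_noether fg jq.
(* Q is enlarged by the objects one step away from it: after that step the coinduction is back in Q,
   since [W] is an extension of B' by [D]. *)
pose S A := P A /\ (Q A \/ exists E N (i : hom A E) (p : hom E N), [/\ ses i p, T E & Q N]).
suff : S `<=` Q.
  apply; split=> //; right; exists E, W, (j ∘ f), w; split=> //.
  exact: rel_extensions kr QD QB'.
apply: rel_cores_inf_coind => M [PM SM]; split=> //.
have : exists E N (i : hom M E) (p : hom E N), [/\ ses i p, T E & Q N].
  by case: SM => // /rel_unfold.
move=> [E' [N [i [p [ip TE' QN]]]]]; exists E', N, i, p; split=> //.
by split; [case: QN | left].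
Qed.

Lemma rel_summands A B : retract A B -> Q B -> Q A.
Proof.
move=> [i [r ri]] QB; have [_ /closed_summandsP PS _] := base_thick.
pose S A := exists B (i : hom A B) (r : hom B A), r ∘ i = idm A /\ Q B.
suff : S `<=` Q by apply; exists B, i, r.
apply: rel_cores_inf_coind => {A B i r ri QB} A [B [i [r [ri QB]]]].
split; first by apply: (PS A B); [exists i, r | case: QB].
have [D [p ip]] := sesT_of_mono (split_mono ri).
have [E [N [j [q [jq TE QN]]]]] := rel_unfold QB.
have [W [w [k [t [jw kt kp _]]]]] := ses_noether ip jq.
exists E, W, (j ∘ i), w; split=> //.
(* [W] is not directly visible in Q, but its sum with [A] is: B is A (+) D, and D -> W -> N gives
   the exact sequence B -> A (+) W -> N. *)
exists (biprod A W), (in2 _ _), (pr2 _ _); split; first exact: pr2in2.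
have st : ses (pair r (k ∘ p)) (t ∘ pr2 A W).
  apply: ses_of_cover.
  - apply: mono0 => Z b b0.
    have rb : r ∘ b = 0 by rewrite -(pr1_pair r (k ∘ p)) -compA b0 compm0.
    have /(mono_eq0 (ses_mono kt))/(ker_lift (proj1 ip))[a ia] : k ∘ (p ∘ b) = 0.
      by rewrite compA -(pr2_pair r (k ∘ p)) -compA b0 compm0.
    suff a0 : a = 0 by rewrite -ia a0 compm0.
    by rewrite -[a]comp1m -ri -compA ia.
  - exact: epi_comp (ses_epi kt) (split_epi (pr2in2 _ _)).
  - by rewrite -compA pr2_pair compA (ses_comp0 kt) comp0m.
  - move=> Z a; rewrite -compA => /(ker_lift (proj1 kt))[d kd].
    have [V [c [b [ce pb]]]] := epi_cover d (ses_epi ip).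
    exists V, c, (b + i ∘ (pr1 _ _ ∘ a ∘ c - r ∘ b)); split=> //.
    apply: biprod_eq; rewrite compA ?pr1_pair ?pr2_pair compDr !compA.
      by rewrite ri comp1m addrC subrK.
    by rewrite (compE (ses_comp0 ip)) compm0 comp0m addr0 (compE pb) compA kd.
exact: rel_extensions st QB QN.
Qed.

Lemma cores_len_rel n M : cores_len T n M -> Q M.
Proof.
elim: n M => [|n IH] M; first exact: add_rel.
by move=> [E [N [i [p [ip /add_rel QE /IH QN]]]]]; apply: rel_epi_kernels ip QE QN.
Qed.

Lemma cores_len_vanish n M A k : cores_len T n M -> Q A -> (n <= k)%N ->
  ext_vanish k A M.
Proof.
elim: n M k => [|n IH] M k; first by move=> TM [PA _] _; apply: base_vanish.
move=> [E [N [i [p [ip TE lN]]]]] QA; case: k => // k nk.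
apply: vanish_first ip _ _; first exact: IH.
by apply: base_vanish => //; case: QA.
Qed.

Lemma vanish_cores_len n M : Q M ->
  (forall A k, Q A -> (n <= k)%N -> ext_vanish k A M) -> cores_len T n M.
Proof.
elim: n M => [|n IH] M QM v; have [E [N [i [p [ip TE QN]]]]] := rel_unfold QM.
  have [r ri] := v N 0%N QN isT (SesT ip).
  by apply: add_retract TE _; exists i, r.
exists E, N, i, p; split=> //; apply: IH => // A k QA nk.
apply: vanish_last ip _ _; first exact: v.
by apply: base_vanish => //; case: QA.
Qed.

(** Because of the index shift in [ext_vanish], [n <= k] here is the strict bound [n < k.+1] of
    [id_rel]. *)
Definition id_le n M : Prop := forall A k, Q A -> (n <= k)%N -> ext_vanish k A M.

Lemma id_rel_finite M : id_rel Q M <> None <-> exists n, id_le n M.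
Proof.
rewrite /id_rel; case: pselect => [h|h]; split=> //.
- have [n /asboolP nP] := h => _; exists n => A k QA nk; exact/Ext_eq0P/nP.
- move=> [n nP]; case: h; exists n; apply/asboolP => A [|k] // QA nk.
  exact/Ext_eq0P/nP.
Qed.

Lemma cores_finE : cores_fin setT T = [set M | Q M /\ id_rel Q M <> None].
Proof.
apply/seteqP; split=> M.
  move=> /(cores_fin_len add_summands)[n lenM]; split; first exact: cores_len_rel lenM.
  by apply/id_rel_finite; exists n => A k QA nk; apply: cores_len_vanish lenM QA nk.
move=> [QM /id_rel_finite[n idM]]; apply: (@cores_len_fin _ _ _ n) => //.
exact: vanish_cores_len.
Qed.

Lemma cores_finX : cores_fin X T = cores_fin setT T.
Proof.
apply/seteqP; split=> M.
  move=> [n [E [f [[f0 fe fn] [[_ RE] RE' fP]]]]]; exists n, E, f; split=> //.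
  by split=> // i /fP[I [e [m [ee mm fE _]]]]; exists I, e, m.
move=> /(cores_fin_len add_summands)[n lenM].
have TX : T `<=` X by move=> A /hTX[].
(* From the right end backwards, each cosyzygy is the kernel of an epi between objects of [X]. *)
apply: cores_len_fin lenM => // k N; elim: k N => [|k IH] N; first exact: TX.
move=> [E [N' [i [p [ip /TX XE /IH XN]]]]].
by have [_ _ /closed_epi_kernelsP XK] := hX; apply: XK ip XE XN.
Qed.

Lemma rel_thick : left_thick Q.
Proof.
split.
- exact/closed_extensionsP/rel_extensions.
- exact/closed_summandsP/rel_summands.
- exact/closed_epi_kernelsP/rel_epi_kernels.
Qed.

(** Bounds on the dimension pass through long exact sequences, so no finite coresolutions have to be
    combined. *)
Lemma id_finite_thick : left_thick [set M | Q M /\ id_rel Q M <> None].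
Proof.
split.
- apply/closed_extensionsP => A B D f g fg [QA /id_rel_finite[n nA]].
  move=> [QD /id_rel_finite[m mD]]; split; first exact: rel_extensions fg QA QD.
  apply/id_rel_finite; exists (maxn n m) => N k QN; rewrite geq_max => /andP[nk mk].
  by apply: vanish_middle fg _ _; [apply: nA | apply: mD].
- apply/closed_summandsP => A B AB [QB /id_rel_finite[n nB]].
  split; first exact: rel_summands AB QB.
  apply/id_rel_finite; exists n => N k QN nk; have [s [r rs]] := AB.
  by apply: vanish_retract rs _; apply: nB.
- apply/closed_epi_kernelsP => A B D f g fg [QB /id_rel_finite[n nB]].
  move=> [QD /id_rel_finite[m mD]]; split; first exact: rel_epi_kernels fg QB QD.
  (* [D] enters one degree lower than the kernel [A], hence [m.+1]; it also excludes the case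
     [k = 0]. *)
  apply/id_rel_finite; exists (maxn n m.+1) => N [|k] QN; rewrite geq_max => /andP[nk] //.
  move=> mk; apply: vanish_first fg _ _; first exact: mD.
  exact: nB.
Qed.

End Tilting.

Theorem corollary4p21 (C : abelianCategory) (X T : set C)
    (hX : left_thick X) (hT : T = add_class T) (hTX : T `<=` right_perp T `&` X) :
  let Q := rel_cores_inf (left_perp T `&` X) T in
  left_thick Q /\
  [/\ cores_fin X T = cores_fin setT T,
      cores_fin setT T = [set M | Q M /\ id_rel Q M <> None]
    & left_thick (cores_fin setT T)].
Proof.
move=> Q; have QT := rel_thick hX hT; split=> //; split.
- exact: cores_finX.
- exact: cores_finE hX hT hTX.
- by rewrite (cores_finE hX hT hTX); apply: id_finite_thick.
Qed.
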